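(* Let $h \geq 2$ be an integer, and for real $x>2$ let $\mathcal{S}_h(x)$ denote the set of $h$-free natural numbers less than or equal to $x$. Then for every $a\in\mathbb{R}$, $$\lim_{x\to\infty}\frac{1}{|\mathcal{S}_h(x)|}\left|\left\{n\in\mathcal{S}_h(x) \ :\ n\ge 3,\ \frac{\omega_1(n)-\log\log n}{\sqrt{\log\log n}}\leq a\right\}\right| = \Phi(a),$$ where $$\Phi(a) = \frac{1}{\sqrt{2\pi}}\int_{-\infty}^a e^{-u^2/2}\,du.$$
   Context: A natural number $n$ is $h$-free if every prime in its factorization has multiplicity at most $h-1$. $\omega_1(n)$ is the number of distinct primes $p$ with $p\,\|\,n$ (i.e. $p\mid n$ and $p^2\nmid n$). *)

(* Defs.v *)
From mathcomp Require Export all_boot all_order all_algebra.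
From mathcomp Require Export finmap.
From mathcomp Require Export all_classical all_reals all_analysis.

Set Implicit Arguments.
Unset Strict Implicit.
Unset Printing Implicit Defensive.

Import Order.TTheory GRing.Theory Num.Theory.
Export numFieldNormedType.Exports.

Local Open Scope classical_set_scope.
Local Open Scope ring_scope.

Definition hfree (h n : nat) : bool :=
  all (fun p => logn p n <= h.-1)%N (primes n).

(* [primes n] lists the prime divisors of n without repetition. *)
Definition omega1 (n : nat) : nat :=
  size [seq p <- primes n | ~~ (p ^ 2 %| n)%N].

(* 0 must be excluded explicitly, since [hfree h 0] holds vacuously. *)
Definition hfree_upto (R : realType) (h : nat) (x : R) : set nat :=
  [set n | (0 < n)%N /\ hfree h n /\ n%:R <= x].

(* [fset_set] sends infinite sets to the empty one, so [ncard] is meaningful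
   for finite sets only; [finite_hfree_upto] provides this. *)
Definition ncard (A : set nat) : nat := (#|` fset_set A|)%fset.

Lemma finite_hfree_upto (R : realType) (h : nat) (x : R) :
  finite_set (hfree_upto h x).
Proof.
apply: (@sub_finite_set _ _ `I_(Num.truncn x).+1); last exact: finite_II.
move=> n [_ [_ nx]] /=; rewrite -(ltr_nat R).
exact: le_lt_trans nx (truncnS_gt x).
Qed.

Definition loglog (R : realType) (n : nat) : R := ln (ln n%:R).

Definition Phi (R : realType) (a : R) : R :=
  (Num.sqrt (2 * pi))^-1 *
  \int[lebesgue_measure]_(u in `]-oo, a]) expR (- u ^+ 2 / 2).

(* Main.v *)
Require Import Defs.
From HB Require Import structures.
From mathcomp Require Import measurable_realfun.
From mathcomp Require Import zify ring lra.
Set Implicit Arguments.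
Unset Strict Implicit.
Unset Printing Implicit Defensive.
Import Order.TTheory GRing.Theory Num.Theory.
Local Open Scope classical_set_scope.
Local Open Scope ring_scope.

(** Up to an error bounded on average, [omega1 n] for [n <= N] is the number of
    primes [p <= z] dividing [n], where [z] is a small power of [N], and by the
    theorems of Mertens [\sum_(p <= z) 1 / p = log log N + O(1)]. Polynomials in
    the indicators [p %| n] have nearly the same average over [n <= M] as over a
    full period [\prod_p p], where the indicators are independent by the Chinese
    remainder theorem. There the average of a cosine of the centred count is
    computed one prime at a time, as in Lindeberg's proof of the central limit
    theorem, and it is carried over to [n <= M] by a Taylor polynomial of the
    cosine. To restrict to [h]-free integers, the conditions [~~ (p ^ h %| n)]
    are imposed one prime at a time: passing from [m] to [p ^ h * m] changes
    [omega1] by at most one, so each condition only multiplies the limit by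
    [1 - p ^ - h]; the conditions for large [p] matter for few [n].
    Convergence of all the averages of [cos (lam * u + nu)] to their Gaussian
    values is turned into convergence of distribution functions by approximating
    the indicator of a half-line, on a bounded window, by a polynomial in
    [sin (t * u + c)], a finite combination of such cosines; bounded first
    absolute moments control the mass outside the window. *)

(** * Chebyshev's bound and the theorems of Mertens *)

(** The indicators are independent only over a full period, which is far longer than [N]; this is
    why the two averages are compared through polynomials. Degree [j] in the centred count costs
    about [z ^ j / N], and this ties the truncation point to the degree of the Taylor polynomial:
    with about [2 * k] terms, [z ^ (4 * k) <= N] leaves an error of order [N ^ (- 1 / 2)]. The
    Taylor remainder is not made small by [N]: it is a constant times [4 ^ - k], by exponential
    moments of the independent model. So [k] is chosen from the desired precision, and then [N]
    grows. Centring and scaling use [log log N], the same for all [n <= N], until the very end. This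
    is what allows [n] to be replaced by [p ^ h * m] inside a cosine, at the price of averages over
    [n <= N / K] with the normalisation of [N]. The phase [nu] lets real cosines do the work of
    characteristic functions. *)

Lemma prod_primes_dvdn (l : seq nat) (n : nat) :
  uniq l -> all prime l -> all (dvdn^~ n) l -> (\prod_(p <- l) p %| n)%N.
Proof.
elim: l => [|p l IH] /=; first by rewrite big_nil dvd1n.
move=> /andP[pl ul] /andP[pp al] /andP[pn aln]; rewrite big_cons Gauss_dvd.
  by rewrite pn IH.
rewrite big_seq; apply: (big_ind (fun x => coprime p x)) => [|x y|q ql].
- exact: coprimen1.
- by rewrite coprimeMr => -> ->.
have /allP/(_ _ ql) pq := al.
by rewrite prime_coprime// dvdn_prime2//; apply: contraNneq pl => ->.
Qed.

Definition primorial (n : nat) := (\prod_(1 <= p < n.+1 | prime p) p)%N.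

(** The primes in []m, 2m]] divide [(2m)!] but not [m!], hence they all divide the central binomial
    coefficient, which is at most [2 ^ (2m)]. *)
Lemma primorial_double (m : nat) :
  (primorial m.*2 <= primorial m * 2 ^ m.*2)%N.
Proof.
rewrite /primorial (@big_cat_nat _ _ _ m.+1)//=; last by rewrite ltnS -addnn leq_addr.
rewrite leq_mul2l; apply/orP; right.
apply: (@leq_trans 'C(m.*2, m)).
  apply: dvdn_leq; first by rewrite bin_gt0 -addnn leq_addr.
  rewrite -big_filter; apply: prod_primes_dvdn.
  - by rewrite filter_uniq ?iota_uniq.
  - by apply/allP => p; rewrite mem_filter => /andP[].
  apply/allP => p; rewrite mem_filter mem_index_iota => /and3P[pp mp pm].
  have : (p %| m.*2`!)%N by rewrite dvdn_fact// prime_gt0.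
  have -> : (m.*2`! = 'C(m.*2, m) * (m`! * m`!))%N.
    by rewrite -[in LHS](@bin_fact m.*2 m) -?addnn ?leq_addr// addnK.
  have np : ~~ (p %| m`!)%N.
    elim: m mp {pm} => [|m IH] mp; first by rewrite fact0 dvdn1 gtn_eqF// prime_gt1.
    rewrite factS Euclid_dvdM// negb_or IH ?(ltnW mp)// andbT gtnNdvd//.
  by rewrite !Euclid_dvdM// (negbTE np) !orbF.
have := expnDn 1 1 m.*2; rewrite addn1 => ->.
rewrite (bigD1 (inord m))//= inordK; last by rewrite ltnS -addnn leq_addr.
by rewrite !exp1n !muln1 leq_addr.
Qed.

(** Strong induction by halving; the constant [4] leaves room for the additional factor [n <= 2 ^ n]
    when [n] is odd. *)
Lemma primorial_le (n : nat) : (primorial n <= 2 ^ (4 * n))%N.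
Proof.
elim/ltn_ind: n => n IH.
have [n0|n0] := posnP n; first by rewrite n0 /primorial big_nil.
have h1 : (primorial n./2.*2 <= 2 ^ (4 * n./2 + n./2.*2))%N.
  apply: (leq_trans (primorial_double _)).
  by rewrite expnD leq_mul2r IH ?orbT//; lia.
have [on|on] := boolP (odd n); last first.
  have -> : primorial n = primorial n./2.*2 by congr primorial; lia.
  by apply: (leq_trans h1); rewrite leq_exp2l//; lia.
have -> : primorial n = primorial n./2.*2.+1 by congr primorial; lia.
rewrite /primorial big_mkcond big_nat_recr//= -big_mkcond/=.
apply: (@leq_trans (2 ^ (4 * n./2 + n./2.*2) * 2 ^ (n./2.*2.+1))).
  apply: leq_mul => //; case: ifP => _; last by rewrite expn_gt0.
  by rewrite ltnW// ltn_expl.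
by rewrite -expnD leq_exp2l//; lia.
Qed.

Section mertens.
Variable R : realType.
Implicit Types (n p k : nat).

Lemma ln_nat_ge0 n : 0 <= ln n%:R :> R.
Proof. by case: n => [|n]; [rewrite ln0 | apply: ln_ge0; rewrite ler1n]. Qed.

Lemma ln_prod_nat (I : Type) (r : seq I) (P : pred I) (F : I -> nat) :
  (forall i, P i -> 0 < F i)%N ->
  ln (\prod_(i <- r | P i) F i)%:R = \sum_(i <- r | P i) ln (F i)%:R :> R.
Proof.
move=> F0; suff [] : (0 < \prod_(i <- r | P i) F i)%N /\
  ln (\prod_(i <- r | P i) F i)%:R = \sum_(i <- r | P i) ln (F i)%:R :> R by [].
apply: (big_rec2 (fun x y => (0 < x)%N /\ ln x%:R = y :> R)).
  by rewrite ln1.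
move=> i x y Pi [x0 <-]; split; first by rewrite muln_gt0 F0.
by rewrite natrM lnM// posrE ltr0n// F0.
Qed.

Lemma sum_ln_prime_le n :
  \sum_(1 <= p < n.+1 | prime p) ln p%:R <= (4 * n)%:R * ln 2 :> R.
Proof.
rewrite -ln_prod_nat => [|p /prime_gt0//].
rewrite mulrC mulr_natr -lnXn// -natrX ler_ln ?posrE ?ltr0n ?expn_gt0//.
  by rewrite ler_nat primorial_le.
by apply: prodn_cond_gt0 => p /prime_gt0.
Qed.

Lemma ln_fact_le n : ln n`!%:R <= n%:R * ln n%:R :> R.
Proof.
elim: n => [|n IH]; first by rewrite fact0 mul0r ln1.
rewrite factS natrM lnM ?posrE ?ltr0n ?fact_gt0// -[X in X * _]natr1 mulrDl mul1r addrC lerD2r.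
apply: (le_trans IH); rewrite ler_wpM2l//.
case: n {IH} => [|n]; first by rewrite [leLHS]ln0// ln_nat_ge0.
by rewrite ler_ln ?posrE ?ltr0n// ler_nat.
Qed.

Lemma ln_fact_ge n : n%:R * ln n%:R - n%:R <= ln n`!%:R :> R.
Proof.
elim: n => [|n IH]; first by rewrite fact0 mul0r ln1 subr0.
rewrite factS natrM lnM ?posrE ?ltr0n ?fact_gt0//.
case: n IH => [|n] IH; first by rewrite fact0 !mulr1n ln1 mulr0 addr0 sub0r oppr_le0.
have h : n.+1%:R * (ln n.+2%:R - ln n.+1%:R) <= 1 :> R.
  rewrite -ln_div ?posrE ?ltr0n// -[n.+2%:R]natr1 mulrDl divff// mul1r.
  apply: (@le_trans _ _ (n.+1%:R * n.+1%:R^-1)); last by rewrite divff.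
  rewrite ler_wpM2l// le_ln1Dx//.
  by apply: (@lt_le_trans _ _ 0); rewrite ?oppr_lt0 ?invr_ge0//.
have := natr1 (R := R) n.+1; move: IH h; set x := ln _`!%:R; nra.
Qed.

(* [- (ln n + 2) / n] telescopes to a majorant of the summand. *)
Lemma sum_ln_div_le n :
  \sum_(2 <= k < n.+1) ln k%:R / (k%:R * (k%:R - 1)) <= 4 - (ln n%:R + 2) / n%:R :> R.
Proof.
have [n1|n1] := leqP n 1.
  rewrite big_geq//; case: n n1 => [|[|//]] _; first by rewrite invr0 mulr0 subr0.
  by rewrite mulr1n ln1 divr1 add0r; lra.
elim: n n1 => // n IH n1.
case: (ltnP 1 n) => [n2|]; last first.
  move=> n2; have -> : n = 1%N by lia.
  rewrite big_nat1.
  have : ln 2 <= 1 :> R by rewrite -[2]/(1 + 1)%R le_ln1Dx.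
  have -> : 2 * (2 - 1) = 2 :> R by lra.
  by set x := ln _ => ?; lra.
rewrite big_nat_recr//=.
apply: (le_trans (lerD (IH n2) (lexx _))).
have n0 : 0 < n%:R :> R by rewrite ltr0n; lia.
have h : n%:R * (ln n.+1%:R - ln n%:R) <= 1 :> R.
  rewrite -ln_div ?posrE ?ltr0n//.
  rewrite -[n.+1%:R]natr1 mulrDl divff ?gt_eqF// mul1r.
  apply: (@le_trans _ _ (n%:R * n%:R^-1)); last by rewrite divff// gt_eqF.
  rewrite (ler_wpM2l (ltW n0))// le_ln1Dx//.
  by apply: (@lt_trans _ _ 0); rewrite ?oppr_lt0 ?invr_gt0//.
have h2 : ln n.+1%:R - ln n%:R <= 1 :> R.
  apply: le_trans h; rewrite ler_peMl//; last by rewrite ler1n; lia.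
  by rewrite subr_ge0 ler_ln ?posrE ?ltr0n// ?ler_nat//; lia.
rewrite -[n.+1%:R]natr1 addrK in h h2 *.
set a := n%:R in n0 h h2 *; set x := ln (a + 1) in h h2 *; set y := ln a in h h2 *.
rewrite -subr_ge0.
have -> : 4 - (x + 2) / (a + 1) - (4 - (y + 2) / a + x / ((a + 1) * a)) =
  (y + 2 - a * (x - y) - x) / (a * (a + 1)).
  by field; rewrite !gt_eqF//; lra.
by rewrite divr_ge0//; nra.
Qed.

Lemma sum_primeE (F : nat -> R) n :
  \sum_(1 <= p < n.+1 | prime p) F p = \sum_(2 <= p < n.+1 | prime p) F p.
Proof.
case: n => [|n]; first by rewrite !big_geq.
by rewrite big_ltn_cond.
Qed.

Lemma sum_prime_le (F : nat -> R) n : (forall k, (1 < k)%N -> 0 <= F k) ->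
  \sum_(2 <= p < n.+1 | prime p) F p <= \sum_(2 <= p < n.+1) F p.
Proof.
move=> F0; rewrite big_mkcond/= big_nat_cond [leRHS]big_nat_cond ler_sum//.
by move=> i /andP[/andP[i2 _] _]; case: ifP => // _; exact: F0.
Qed.

(** The first theorem of Mertens comes from comparing this factorisation with the weak Stirling
    bounds above. *)
Lemma ln_fact_sum n :
  ln n`!%:R = \sum_(1 <= p < n.+1 | prime p) (logn p n`!)%:R * ln p%:R :> R.
Proof.
rewrite {1}[n`!]prod_prime_decomp ?fact_gt0// prime_decompE big_map/= ln_prod_nat.
  rewrite (eq_bigr (fun p => (logn p n`!)%:R * ln p%:R)); last first.
    move=> p _; rewrite natrX mulr_natl.
    case: p => [|p]; last by rewrite lnXn.
    by rewrite lognE/= mulr0n expr0 ln1.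
  rewrite -[RHS]big_filter; apply: perm_big; apply: uniq_perm.
  - exact: primes_uniq.
  - by rewrite filter_uniq ?iota_uniq.
  move=> p; rewrite mem_primes mem_filter mem_index_iota fact_gt0/= ltnS.
  case: (boolP (prime p)) => //= pp; rewrite prime_gt0//=.
  apply/idP/idP => [pn|pn]; last by rewrite dvdn_fact// prime_gt0.
  elim: n pn => [|n IH]; first by rewrite fact0 dvdn1 => /eqP p1; rewrite p1 in pp.
  rewrite factS Euclid_dvdM// => /orP[/dvdn_leq->//|/IH/leq_trans->//].
by move=> p _; rewrite expn_gt0; case: p.
Qed.

Lemma logn_fact_ge p n : prime p -> n%:R / p%:R - 1 <= (logn p n`!)%:R :> R.
Proof.
move=> pp; rewrite logn_fact//; case: n => [|n]; first by rewrite mul0r sub0r (le_trans _ (ler0n _ _))// oppr_le0.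
rewrite big_ltn// expn1 natrD -lerBDr.
apply: (@le_trans _ _ (n.+1%:R / p%:R - 1)); first by rewrite gerBl.
rewrite lerBlDr natr1 ler_pdivrMr ?ltr0n ?prime_gt0// -natrM ler_nat ltnW//.
by rewrite ltn_ceil// prime_gt0.
Qed.

Lemma logn_fact_le p n : prime p -> (logn p n`!)%:R <= n%:R / (p%:R - 1) :> R.
Proof.
move=> pp; rewrite logn_fact//.
have p0 : 0 < p%:R :> R by rewrite ltr0n prime_gt0.
have p1 : 0 < p%:R - 1 :> R by rewrite subr_gt0 ltr1n prime_gt1.
(* Keeping the exact partial sum of the geometric series, instead of its limit, makes the induction
   close. *)
suff h m : (\sum_(1 <= k < m.+1) n %/ p ^ k)%:R <=
   n%:R / (p%:R - 1) * (1 - p%:R ^- m) :> R.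
  by apply: (le_trans (h n)); rewrite ler_piMr ?divr_ge0// ?(ltW p1)//.
elim: m => [|m IH]; first by rewrite big_geq// expr0 invr1 subrr mulr0.
rewrite big_nat_recr//= natrD.
have h : (n %/ p ^ m.+1)%:R <= n%:R / p%:R ^+ m.+1 :> R.
  by rewrite ler_pdivlMr ?exprn_gt0// -natrX -natrM ler_nat leq_trunc_div.
apply: (le_trans (lerD IH h)).
rewrite le_eqVlt; apply/orP; left; apply/eqP.
rewrite exprS invfM.
have pm : p%:R ^+ m != 0 :> R by rewrite expf_eq0 gt_eqF ?andbF.
by field; rewrite !gt_eqF// exprn_gt0.
Qed.

Definition mertens1_sum n : R := \sum_(1 <= p < n.+1 | prime p) ln p%:R / p%:R.

(** Replacing the exponent of [p] in [n!] by [n / p] loses at most [1] for each prime, in total at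
    most [4 * n * ln 2] by Chebyshev's bound. *)
Lemma mertens1_upper n : (0 < n)%N -> mertens1_sum n <= ln n%:R + 4.
Proof.
move=> n0; have n0R : 0 < n%:R :> R by rewrite ltr0n.
rewrite -(ler_pM2l n0R).
have h : n%:R * mertens1_sum n - \sum_(1 <= p < n.+1 | prime p) ln p%:R <= ln n`!%:R.
  rewrite ln_fact_sum mulr_sumr -sumrB ler_sum// => p pp.
  apply: le_trans (ler_wpM2r (ln_nat_ge0 p) (logn_fact_ge n pp)).
  by rewrite mulrBl mul1r mulrA mulrAC.
have h1 := ln_fact_le n; have h2 := sum_ln_prime_le n.
have h3 : ln 2 <= 1 :> R by rewrite -[2]/(1 + 1)%R le_ln1Dx.
rewrite natrM in h2; move: h h1 h2 h3.
set a := \sum_(_ <= _ < _ | _) _; set b := ln n`!%:R; set c := ln 2; set x := n%:R.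
by move=> *; rewrite mulrDr; nra.
Qed.

(** Here [1 / (p - 1) = 1 / p + 1 / (p * (p - 1))]: the convergent part contributes at most [4], and
    Stirling's bound the remaining [1]. *)
Lemma mertens1_lower n : (0 < n)%N -> ln n%:R - 5 <= mertens1_sum n.
Proof.
move=> n0; have n0R : 0 < n%:R :> R by rewrite ltr0n.
rewrite -(ler_pM2l n0R).
have h : ln n`!%:R <= n%:R * mertens1_sum n +
    n%:R * \sum_(1 <= p < n.+1 | prime p) ln p%:R / (p%:R * (p%:R - 1)).
  rewrite ln_fact_sum !mulr_sumr -big_split/= ler_sum// => p pp.
  apply: (le_trans (ler_wpM2r (ln_nat_ge0 p) (logn_fact_le n pp))).
  have p0 : 0 < p%:R :> R by rewrite ltr0n prime_gt0.
  have p1 : 0 < p%:R - 1 :> R by rewrite subr_gt0 ltr1n prime_gt1.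
  by rewrite le_eqVlt; apply/orP; left; apply/eqP; field; rewrite !gt_eqF.
have h1 : \sum_(1 <= p < n.+1 | prime p) ln p%:R / (p%:R * (p%:R - 1)) <= 4 :> R.
  rewrite sum_primeE; apply: le_trans (sum_prime_le _ _) _.
    move=> k k1; rewrite divr_ge0 ?ln_nat_ge0// mulr_ge0// subr_ge0 ler1n ltnW//.
  apply: le_trans (sum_ln_div_le n) _; rewrite gerBl divr_ge0// addr_ge0//.
  exact: ln_nat_ge0.
have h2 := ln_fact_ge n; move: h h1 h2; move: (mertens1_sum n).
set a := \sum_(_ <= _ < _ | _) _; set b := ln n`!%:R; set x := n%:R => ? *; nra.
Qed.

Lemma mertens1 n : (0 < n)%N -> `|mertens1_sum n - ln n%:R| <= 5.
Proof.
move=> n0; have := mertens1_lower n0; have := mertens1_upper n0.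
by rewrite ler_norml => *; apply/andP; split; lra.
Qed.

Definition prime_recip_sum n : R := \sum_(1 <= p < n.+1 | prime p) p%:R^-1.

(** Both quantities lie between [(b - a) / b] and [(b - a) / a]. It is used with [a = ln n] and
    [b = ln (n + 1)], where the right-hand side telescopes. *)
Lemma lnln_increment (a b : R) : 0 < a -> a <= b -> b - a <= 1 ->
  `|(b - a) / b - (ln b - ln a)| <= a^-1 - b^-1.
Proof.
move=> a0 ab ba1; have b0 : 0 < b by lra.
have h1 : ln b - ln a <= (b - a) / a.
  rewrite -ln_div ?posrE//.
  have -> : b / a = 1 + (b - a) / a by field; rewrite gt_eqF.
  rewrite le_ln1Dx// (lt_le_trans (ltrN10 _))// divr_ge0//; lra.
have h2 : (b - a) / b <= ln b - ln a.
  rewrite -[leRHS]opprB lerNr -ln_div ?posrE//.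
  have -> : a / b = 1 + - ((b - a) / b) by field; rewrite gt_eqF.
  by rewrite le_ln1Dx// ltrN2 ltr_pdivrMr//; lra.
have -> : a^-1 - b^-1 = (b - a) / (a * b) by field; rewrite !gt_eqF.
have h3 : (b - a) / a - (b - a) / b <= (b - a) / (a * b).
  have -> : (b - a) / a - (b - a) / b = (b - a) / (a * b) * (b - a).
    by field; rewrite !gt_eqF.
  by rewrite ler_piMr// divr_ge0 ?mulr_ge0//; lra.
by rewrite ler_norml; apply/andP; split; lra.
Qed.

(* Abel summation: subtracting [(M n - ln n) / ln n], with [M] the sum of the
   first theorem, leaves increments bounded by those of [-1 / ln n]. *)
Lemma mertens2 : exists C : R, forall n, (1 < n)%N ->
  `|prime_recip_sum n - ln (ln n%:R)| <= C.
Proof.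
pose E n := mertens1_sum n - ln n%:R.
pose B n := prime_recip_sum n - E n / ln n%:R - ln (ln n%:R).
have lnp n : (1 < n)%N -> 0 < ln n%:R :> R by move=> n1; rewrite ln_gt0// ltr1n.
have lnS n : (1 < n)%N -> ln n%:R <= ln n.+1%:R :> R.
  by move=> n1; rewrite ler_ln ?posrE ?ltr0n ?ler_nat//; lia.
have BS n : (1 < n)%N -> `|B n.+1 - B n| <= 6 * ((ln n%:R)^-1 - (ln n.+1%:R)^-1).
  move=> n1; have := mertens1 (ltnW n1).
  have b0 : 0 < ln n.+1%:R :> R by apply: lnp; lia.
  have step (F : nat -> R) : \sum_(1 <= p < n.+2 | prime p) F p =
      \sum_(1 <= p < n.+1 | prime p) F p + (prime n.+1)%:R * F n.+1.
    by rewrite big_mkcond big_nat_recr//= -big_mkcond/=; case: (prime _); rewrite ?mul1r ?mul0r.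
  have inc : `|(ln n.+1%:R - ln n%:R) / ln n.+1%:R -
      (ln (ln n.+1%:R) - ln (ln n%:R))| <= (ln n%:R)^-1 - (ln n.+1%:R)^-1 :> R.
    apply: lnln_increment; rewrite ?lnp ?lnS//.
    rewrite -ln_div ?posrE ?ltr0n//; last by lia.
    rewrite -[n.+1%:R]natr1 mulrDl divff ?pnatr_eq0; last by lia.
    apply: (@le_trans _ _ (1 * n%:R^-1)); last by rewrite mul1r invf_le1 ?ler1n ?ltr0n; lia.
    rewrite le_ln1Dx// (lt_le_trans (ltrN10 _))//.
  have -> : B n.+1 - B n = (mertens1_sum n - ln n%:R) * ((ln n%:R)^-1 - (ln n.+1%:R)^-1) +
      ((ln n.+1%:R - ln n%:R) / ln n.+1%:R - (ln (ln n.+1%:R) - ln (ln n%:R))).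
    rewrite /B /E /mertens1_sum /prime_recip_sum !step.
    move: (lnp _ n1) b0; set a := ln n%:R; set b := ln n.+1%:R => a0 b0.
    have nS0 : n.+1%:R != 0 :> R by rewrite pnatr_eq0.
    by field; rewrite !gt_eqF//= nS0.
  move=> En; apply: (le_trans (ler_normD _ _)).
  have -> (x : R) : 6 * x = 5 * x + x by ring.
  have d0 : 0 <= (ln n%:R)^-1 - (ln n.+1%:R)^-1 :> R by exact: le_trans inc.
  by apply: lerD => //; rewrite normrM (ger0_norm d0) ler_wpM2r.
have Bn n : (1 < n)%N -> `|B n| <= `|B 2| + 6 * ((ln 2)^-1 - (ln n%:R)^-1).
  elim: n => // n IH nS1; case: (ltnP 1 n) => [n1|n1]; last first.
    have -> : n = 1%N by lia.
    by rewrite subrr mulr0 addr0.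
  have := BS _ n1; have := IH n1; have := ler_normD (B n) (B n.+1 - B n).
  by rewrite subrKC; lra.
exists (`|B 2| + 6 * (ln 2)^-1 + 5 * (ln 2)^-1) => n n1.
have -> : prime_recip_sum n - ln (ln n%:R) = B n + E n / ln n%:R by rewrite /B; ring.
apply: (le_trans (ler_normD _ _)); apply: lerD.
  apply: (le_trans (Bn _ n1)); rewrite lerD2l ler_pM2l// gerBl invr_ge0.
  by rewrite ltW// lnp.
rewrite normrM ler_pM//; first exact: mertens1 (ltnW n1).
rewrite ger0_norm ?invr_ge0 ?(ltW (lnp _ n1))// lef_pV2 ?posrE ?lnp//.
by rewrite ler_ln ?posrE ?ltr0n ?ler_nat//; lia.
Qed.

End mertens.

(** * Counting prime divisors from a fixed set *)

Section average.
Variable R : realType.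
Implicit Types (f g : nat -> R) (M D : nat).

Definition avg M f : R := (\sum_(1 <= n < M.+1) f n) / M%:R.

Lemma eq_avg M f g : (forall n, (0 < n <= M)%N -> f n = g n) -> avg M f = avg M g.
Proof.
move=> fg; congr (_ / _); rewrite big_nat_cond [RHS]big_nat_cond.
by apply: eq_bigr => n /andP[/andP[n0 nM] _]; rewrite fg// n0.
Qed.

Lemma avgD M f g : avg M (fun n => f n + g n) = avg M f + avg M g.
Proof. by rewrite /avg big_split/= mulrDl. Qed.

Lemma avgZ M c f : avg M (fun n => c * f n) = c * avg M f.
Proof. by rewrite /avg -mulr_sumr mulrA. Qed.

Lemma avg_sum (I : Type) (r : seq I) (F : I -> nat -> R) M :
  avg M (fun n => \sum_(i <- r) F i n) = \sum_(i <- r) avg M (F i).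
Proof. by rewrite /avg exchange_big/= mulr_suml. Qed.

Lemma le_avg M f g : (forall n, (0 < n <= M)%N -> f n <= g n) -> avg M f <= avg M g.
Proof.
move=> fg; rewrite ler_wpM2r// ?invr_ge0//.
rewrite big_nat_cond [leRHS]big_nat_cond.
by apply: ler_sum => n /andP[/andP[n0 nM] _]; rewrite fg// n0.
Qed.

Lemma avg_ge0 M f : (forall n, (0 < n <= M)%N -> 0 <= f n) -> 0 <= avg M f.
Proof.
move=> f0; rewrite divr_ge0// big_nat_cond.
by apply: sumr_ge0 => n /andP[/andP[n0 nM] _]; rewrite f0// n0.
Qed.

Lemma avg_cst M (c : R) : (0 < M)%N -> avg M (fun=> c) = c.
Proof.
move=> M0; rewrite /avg sumr_const_nat subn1/= -[c *+ M]mulr_natr mulfK//.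
by rewrite pnatr_eq0 -lt0n.
Qed.

Lemma ler_norm_avg M f : `|avg M f| <= avg M (fun n => `|f n|).
Proof.
rewrite /avg normrM [ `|_^-1| ]ger0_norm ?invr_ge0// ler_wpM2r ?invr_ge0//.
exact: ler_norm_sum.
Qed.

Lemma ler_dist_avg M f g :
  `|avg M f - avg M g| <= avg M (fun n => `|f n - g n|).
Proof.
rewrite -[_ - _]/(_ + _) -mulN1r -avgZ -avgD.
by apply: le_trans (ler_norm_avg _ _) _; apply: le_avg => n _; rewrite mulN1r.
Qed.

Lemma sum_multiples f M d : (0 < d)%N ->
  \sum_(1 <= n < M.+1) (d %| n)%:R * f n = \sum_(1 <= m < (M %/ d).+1) f (d * m)%N.
Proof.
move=> d0; elim: M => [|M IH]; first by rewrite div0n !big_geq.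
rewrite big_nat_recr//= IH divnS//.
case: (boolP (d %| M.+1)%N) => dM; last by rewrite mul0r addr0.
rewrite add1n [RHS]big_nat_recr//= mul1r; congr (_ + f _).
by rewrite -[LHS](divnK dM) mulnC divnS// dM.
Qed.

Lemma sum_periodic f D (p : nat) : (forall n, f (n + D)%N = f n) ->
  \sum_(1 <= n < (p * D).+1) f n = p%:R * \sum_(1 <= n < D.+1) f n.
Proof.
move=> fD; elim: p => [|p IH]; first by rewrite mul0n big_geq// mul0r.
rewrite (@big_cat_nat _ _ _ (p * D).+1)//=; last by rewrite ltnS leq_mul2r leqnSn orbT.
rewrite IH -natr1 mulrDl mul1r; congr (_ + _).
rewrite -[X in X.+1]add0n -addSn mulSn -addSn big_addn addnK.
apply: eq_bigr => n _.
by elim: p {IH} => [|p IH]; rewrite ?addn0// mulSn addnCA addnC fD.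
Qed.

(* [D] only has to be a multiple of [d]; the comparison with its average
   replaces the comparison with the density [1 / d]. *)
Lemma avg_dvdn M D (d : nat) : (0 < M)%N -> (0 < D)%N -> (d %| D)%N ->
  `|avg M (fun n => (d %| n)%:R) - avg D (fun n => (d %| n)%:R)| <= M%:R^-1.
Proof.
move=> M0 D0 dD; have d0 : (0 < d)%N by case: d dD => //; rewrite dvd0n; lia.
have E K : \sum_(1 <= n < K.+1) (d %| n)%:R = (K %/ d)%:R :> R.
  under eq_bigr do rewrite -[(_ %| _)%:R]mulr1.
  by rewrite (sum_multiples (fun=> 1))// sumr_const_nat subn1.
have M0R : 0 < M%:R :> R by rewrite ltr0n.
have D0R : 0 < D%:R :> R by rewrite ltr0n.
have d0R : 0 < d%:R :> R by rewrite ltr0n.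
rewrite /avg !E.
have -> : (D %/ d)%:R / D%:R = d%:R^-1 :> R.
  have : D%:R = (D %/ d)%:R * d%:R :> R by rewrite -natrM divnK.
  move=> ->; have : (D %/ d)%:R != 0 :> R.
    by rewrite pnatr_eq0 -lt0n divn_gt0// dvdn_leq.
  by move=> ?; rewrite invfM mulrA divff// mul1r.
have -> : (M %/ d)%:R / M%:R - d%:R^-1 = ((M %/ d)%:R * d%:R - M%:R) / d%:R / M%:R :> R.
  by field; rewrite !gt_eqF.
rewrite normrM [ `|M%:R^-1| ]ger0_norm ?invr_ge0// ler_piMl ?invr_ge0//.
rewrite normrM [ `|d%:R^-1| ]ger0_norm ?invr_ge0// ler_pdivrMr// mul1r.
rewrite -natrM distrC ger0_norm ?subr_ge0 ?ler_nat ?leq_trunc_div//.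
by rewrite lerBlDr -natrD ler_nat; rewrite {1}(divn_eq M d) addnC leq_add2r ltnW// ltn_mod.
Qed.

End average.

(** * Divisor counts over an interval and over a full period *)

Section divisor_count.
Variable R : realType.
Implicit Types (l : seq nat) (F : nat -> R).

Definition ndiv l (n : nat) : nat := count (fun p => p %| n)%N l.

Lemma ndivE l n : (ndiv l n)%:R = \sum_(p <- l) (p %| n)%:R :> R.
Proof.
by rewrite /ndiv -sum1_count natr_sum big_mkcond/=; apply: eq_bigr => p _; case: ifP.
Qed.

(* A polynomial in divisibility indicators is averaged with error at most the
   sum of the absolute values of its coefficients. *)
Lemma moment_match l (c : R) M D : (0 < M)%N -> (0 < D)%N ->
  all (dvdn^~ D) l -> forall (j d : nat), (d %| D)%N ->
  `|avg M (fun n => ((ndiv l n)%:R - c) ^+ j * (d %| n)%:R) -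
    avg D (fun n => ((ndiv l n)%:R - c) ^+ j * (d %| n)%:R)| <=
  ((size l)%:R + `|c|) ^+ j / M%:R.
Proof.
move=> M0 D0 lD; elim=> [|j IH] d dD.
  rewrite expr0 mul1r; have := avg_dvdn R M0 D0 dD.
  by congr (`| _ - _ | <= _); apply: eq_avg => n _; rewrite expr0 mul1r.
(* Expanding one factor merges [p %| n] and [d %| n] into divisibility by their least common
   multiple; this is why the induction carries the factor [d %| n]. *)
have E K : avg K (fun n => ((ndiv l n)%:R - c) ^+ j.+1 * (d %| n)%:R) =
   \sum_(p <- l) avg K (fun n => ((ndiv l n)%:R - c) ^+ j * (lcmn p d %| n)%:R)
   - c * avg K (fun n => ((ndiv l n)%:R - c) ^+ j * (d %| n)%:R).
  rewrite -avg_sum -mulNr -avgZ -avgD; apply: eq_avg => n _.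
  rewrite -mulr_sumr exprSr -mulrA mulrBl {2}ndivE mulr_suml mulrBr mulNr [_ ^+ j * (c * _)]mulrCA.
  congr (_ * _ - _); apply: eq_bigr => p _.
  by rewrite dvdn_lcm -natrM mulnb.
rewrite !E opprD addrACA -opprD -sumrB -mulrBr exprS mulrDl mulrDl.
apply: (le_trans (ler_normB _ _)); apply: lerD; last by rewrite normrM -mulrA ler_wpM2l// IH.
apply: (le_trans (ler_norm_sum _ _ _)).
rewrite -mulrA; have -> (x : R) : (size l)%:R * x = \sum_(p <- l) x.
  by rewrite -sum1_size natr_sum mulr_suml; under eq_bigr do rewrite mul1r.
rewrite big_seq [leRHS]big_seq.
apply: ler_sum => p pl; apply: IH.
by rewrite dvdn_lcm dD andbT; apply: (allP lD).
Qed.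

(* Over a full period the events [p %| n], for [p] in [l], are independent of
   probabilities [1 / p]: see [model_cons]. *)
Definition model l F : R := avg (\prod_(p <- l) p)%N (F \o ndiv l).

Lemma model_nil F : model [::] F = F 0%N.
Proof. by rewrite /model/= big_nil /avg big_nat1 divr1. Qed.

Lemma prod_primes_gt0 l : all prime l -> (0 < \prod_(p <- l) p)%N.
Proof.
by move=> /allP pl; rewrite big_seq prodn_cond_gt0// => p /pl /prime_gt0.
Qed.

Lemma dvdn_prod_seq l p : p \in l -> (p %| \prod_(q <- l) q)%N.
Proof.
elim: l => // q l IH; rewrite inE big_cons => /orP[/eqP->|/IH]; first exact: dvdn_mulr.
exact: dvdn_mull.
Qed.

Lemma coprime_prod_seq l p : prime p -> all prime l -> p \notin l ->
  coprime p (\prod_(q <- l) q).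
Proof.
move=> pp; elim: l => [|q l IH]/=; first by rewrite big_nil coprimen1.
case/andP=> pq al; rewrite inE negb_or big_cons coprimeMr => /andP[npq pl].
by rewrite IH// andbT prime_coprime// dvdn_prime2.
Qed.

(** The Chinese remainder theorem appears as two invariances: multiplication by [p] does not change
    the count over [l], and neither does a shift by the period of [l]. The non-multiples of [p] are
    obtained by subtraction. *)
Lemma model_cons p l F : prime p -> all prime l -> p \notin l ->
  model (p :: l) F = p%:R^-1 * model l (fun k => F k.+1) + (1 - p%:R^-1) * model l F.
Proof.
move=> pp al pl; have D0 := prod_primes_gt0 al; have cop := coprime_prod_seq pp al pl.
have dvl q : q \in l -> (q %| \prod_(q <- l) q)%N by exact: dvdn_prod_seq.
rewrite /model big_cons; move: D0 cop dvl; set D := (\prod_(_ <- _) _)%N => D0 cop dvl.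
have p0 := prime_gt0 pp.
have per n : ndiv l (n + D) = ndiv l n.
  by apply: eq_in_count => q /dvl qD; rewrite dvdn_addl.
have mul n : ndiv l (p * n) = ndiv l n.
  apply: eq_in_count => q /dvl qD; rewrite Gauss_dvdr//.
  by rewrite coprime_sym; apply: coprime_dvdr qD cop.
have DR : D%:R != 0 :> R by rewrite pnatr_eq0 -lt0n.
have pR : p%:R != 0 :> R by rewrite pnatr_eq0 -lt0n.
have H G : avg (p * D) (fun n => (p %| n)%:R * G (ndiv l n)) = p%:R^-1 * avg D (G \o ndiv l) :> R.
  rewrite /avg (sum_multiples (G \o ndiv l))// mulKn// natrM.
  under eq_bigr do rewrite /= mul.
  by rewrite /=; field; rewrite pR DR.
have P G : avg (p * D) (G \o ndiv l) = avg D (G \o ndiv l) :> R.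
  rewrite /avg sum_periodic => [|n /=]; last by rewrite per.
  by rewrite natrM; field; rewrite pR DR.
rewrite mulrBl mul1r -(H (fun k => F k.+1)) -(H F) -(P F) -mulN1r -avgZ -!avgD; apply: eq_avg => n _ /=.
by case: (p %| n)%N; rewrite ?add1n ?add0n/=; ring.
Qed.

Definition recips l : R := \sum_(p <- l) p%:R^-1.

(** The tangent bound [1 - x / 2 <= expR (- x / 2)], squared and inverted, bounds [expR x] from
    above. *)
Lemma expR_le_quad (x : R) : `|x| <= 1 -> expR x <= 1 + x + 2 * x ^+ 2.
Proof.
rewrite ler_norml => /andP[x0 x1].
have h := expR_ge1Dx (- (x / 2)).
have -> : expR x = (expR (- (x / 2)) ^+ 2)^-1.
  by rewrite -expRM_natl mulrN -expRN opprK mulrC divfK.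
have h0 : 0 < (1 - x / 2) ^+ 2 by rewrite exprn_gt0//; lra.
apply: (@le_trans _ _ ((1 - x / 2) ^+ 2)^-1).
  rewrite lef_pV2 ?posrE//; last by rewrite exprn_gt0// expR_gt0.
  by rewrite lerXn2r ?nnegrE ?expR_ge0//; lra.
rewrite invf_ple ?posrE//; last by nra.
rewrite -[leLHS]div1r ler_pdivrMr; last by nra.
suff : 0 <= x ^+ 2 * ((1 - x) * (5 / 2 - x)) by lra.
by rewrite mulr_ge0 ?sqr_ge0// mulr_ge0; lra.
Qed.

(** By independence the uncentred moment is a product of factors [1 + q * (expR s - 1)], each at
    most [expR (q * (expR s - 1))], the Poisson value. Centring removes the linear term of the
    exponent. *)
Lemma model_expR l (s : R) : uniq l -> all prime l -> `|s| <= 1 ->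
  model l (fun k => expR (s * (k%:R - recips l))) <= expR (2 * s ^+ 2 * recips l).
Proof.
move=> ul al s1; have es := expR_le_quad s1.
suff h : model l (fun k => expR (s * k%:R)) <= expR ((expR s - 1) * recips l).
  have -> : model l (fun k => expR (s * (k%:R - recips l))) =
      expR (- (s * recips l)) * model l (fun k => expR (s * k%:R)).
    by rewrite /model -avgZ; apply: eq_avg => n _ /=; rewrite mulrBr addrC expRD.
  apply: (le_trans (ler_wpM2l (expR_ge0 _) h)).
  rewrite -expRD ler_expR -mulNr -mulrDl ler_wpM2r//; last by lra.
  by apply: sumr_ge0 => p _; rewrite invr_ge0.
elim: l ul al => [|p l IH] /=; first by rewrite model_nil /recips big_nil !mulr0.
case/andP=> pl ul /andP[pp al]; rewrite model_cons//.
have -> : model l (fun k => expR (s * k.+1%:R)) = expR s * model l (fun k => expR (s * k%:R)).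
  by rewrite /model -avgZ; apply: eq_avg => n _ /=; rewrite -natr1 mulrDr mulr1 expRD mulrC.
rewrite mulrA -mulrDl /recips big_cons mulrDr expRD ler_pM//.
- rewrite addr_ge0 ?mulr_ge0 ?expR_ge0 ?invr_ge0// subr_ge0 invf_le1 ?ler1n ?ltr0n ?prime_gt0//.
- by apply: avg_ge0 => n _; exact: expR_ge0.
- by apply: le_trans (expR_ge1Dx _); rewrite le_eqVlt; apply/orP; left; apply/eqP; ring.
- exact: IH.
Qed.

End divisor_count.

(** * Taylor polynomials of the cosine *)

Section cos_taylor.
Variable R : realType.
Implicit Types (x t nu : R).

Lemma derive_ge0_le (f df : R -> R) x : (forall t, is_derive t 1 f (df t)) ->
  (forall t, 0 <= t -> 0 <= df t) -> 0 <= x -> f 0 <= f x.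
Proof.
move=> fdf df0 x0.
have [c|c] := @MVT_segment R f df 0 x x0 (fun t _ => fdf t).
  apply: continuous_subspaceT => t; apply: differentiable_continuous.
  by apply/derivable1_diffP; have [] := fdf t.
rewrite in_itv/= => /andP[c0 _] /eqP; rewrite subr_eq => /eqP ->.
by rewrite lerDr subr0 mulr_ge0// df0.
Qed.

(** The Taylor polynomial of [x |-> cos (x + nu)] with [m] terms. Successive derivatives of the
    cosine are shifts by [pi / 2], so one formula gives all coefficients, and differentiation only
    drops a term and shifts [nu]. *)
Definition cos_taylor m nu : {poly R} :=
  \poly_(j < m) (cos (nu + j%:R * (pi / 2)) / j`!%:R).

Lemma deriv_cos_taylor m nu :
  (cos_taylor m.+1 nu)^`() = cos_taylor m (nu + pi / 2).
Proof.
apply/polyP => j; rewrite coef_deriv !coef_poly ltnS; case: ifP => _; last by rewrite mul0rn.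
rewrite -natr1 mulrDl mul1r [j%:R * _ + _]addrC addrA factS natrM invfM mulrA.
by rewrite -mulrnAr -mulrnAl -[_ *+ j.+1]mulr_natr mulVf ?pnatr_eq0// mul1r.
Qed.

Lemma cos_taylor0 m nu : (cos_taylor m.+1 nu).[0] = cos nu.
Proof. by rewrite horner_coef0 coef_poly/= mul0r addr0 fact0 divr1. Qed.

(** For [x >= 0], the bound with [m] terms at phase [nu + pi / 2] is the derivative of the bound
    with [m + 1] terms at phase [nu]. Negative [x] are reached by reflection. *)
Lemma cos_taylor_bound m nu x :
  `|cos (x + nu) - (cos_taylor m nu).[x]| <= `|x| ^+ m / m`!%:R.
Proof.
wlog x0 : nu x / 0 <= x.
  move=> H; have [|x0] := leP 0 x; first exact: H.
  have := H (- nu) (- x); rewrite oppr_ge0 => /(_ (ltW x0)).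
  rewrite -opprD cosN normrN; congr (`| _ - _ | <= _).
  rewrite !horner_poly; apply: eq_bigr => j _.
  rewrite [(- x) ^+ j]exprNn [LHS]mulrA; congr (_ * _); rewrite [LHS]mulrAC; congr (_ / _).
  have := cosN (nu + j%:R * (pi / 2)).
  (* The sign [(-1) ^ j] of the reflected monomial is produced by [j] shifts by [pi]. *)
  have -> : - nu + j%:R * (pi / 2) = - (nu + j%:R * (pi / 2)) + pi *+ j.
    by rewrite -mulr_natr; field.
  move=> <-; elim: (j : nat) (- _) => [|k IH] y; first by rewrite addr0 mulr1.
  by rewrite mulrSr addrA cosDpi exprSr mulrN1 mulrNN IH.
rewrite (ger0_norm x0).
elim: m nu x x0 => [|m IH] nu x x0.
  by rewrite /cos_taylor horner_poly big_ord0 subr0 expr0 fact0 divr1 cos_max.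
pose q : {poly R} := (m.+1`!%:R^-1) *: 'X^(m.+1).
have qE t : q.[t] = t ^+ m.+1 / m.+1`!%:R by rewrite /q !hornerE mulrC.
have q'E t : q^`().[t] = t ^+ m / m`!%:R.
  rewrite /q derivZ derivXn hornerZ hornerMn hornerXn factS natrM invfM.
  by rewrite -[(t ^+ _) *+ _]mulr_natl mulrACA mulVf ?pnatr_eq0// mul1r mulrC.
have dcos t : is_derive t 1 (cos \o (id + cst nu)) (cos (t + (nu + pi / 2))).
  by apply: is_derive_eq; rewrite addr0 mulr1 addrA cosDpihalf.
(* The sign [e] treats both one-sided bounds at once: [p - e * cos] vanishes at [0] and has a
   nonnegative derivative. *)
have H (e : R) : e = 1 \/ e = -1 ->
    e * (cos (x + nu) - (cos_taylor m.+1 nu).[x]) <= x ^+ m.+1 / m.+1`!%:R.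
  move=> e1; pose p := q + e *: cos_taylor m.+1 nu.
  have pE t : p.[t] = t ^+ m.+1 / m.+1`!%:R + e * (cos_taylor m.+1 nu).[t].
    by rewrite /p hornerD qE hornerZ.
  have p'E t : p^`().[t] = t ^+ m / m`!%:R + e * (cos_taylor m (nu + pi / 2)).[t].
    by rewrite /p derivD hornerD q'E derivZ deriv_cos_taylor hornerZ.
  have := @derive_ge0_le (horner p - e \*: (cos \o (id + cst nu)))
    (fun t => p^`().[t] - e * cos (t + (nu + pi / 2))) x _ _ x0.
  rewrite /= !fctE pE pE cos_taylor0 expr0n/= mul0r !add0r /GRing.scale/= subrr.
  move=> h; rewrite mulrBr lerBlDr -subr_ge0; apply: h => t t0.
  rewrite p'E -addrA -mulrBr -opprB mulrN subr_ge0.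
  have := IH (nu + pi / 2) t t0; rewrite ler_norml => /andP[h1 h2].
  by case: e1 => ->; lra.
rewrite ler_norml; apply/andP; split; last by rewrite -[leLHS]mul1r H//; left.
by rewrite lerNl -mulN1r H//; right.
Qed.

End cos_taylor.

(** * Cosines and moments in the independent model *)

Section lindeberg.
Variable R : realType.
Implicit Types (l : seq nat) (s nu : R).

Lemma cos_taylor3 x nu :
  `|cos (x + nu) - (cos nu - x * sin nu - x ^+ 2 / 2 * cos nu)| <= `|x| ^+ 3 / 6 :> R.
Proof.
have := cos_taylor_bound 3 nu x.
rewrite horner_poly !big_ord_recl big_ord0/= /bump/= !add1n.
rewrite mul0r addr0 mul1r cosDpihalf (_ : 2 * (pi / 2) = pi); last by field.
rewrite cosDpi expr0 expr1 !mulr1 addr0 !factE/=.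
by congr (`| _ - _ | <= _); field.
Qed.

(** A centred Bernoulli variable is expanded to second order. The Gaussian factor has [q] in place
    of the variance [q * (1 - q)], so that the factors multiply to an exponential of [recips]; the
    change costs the term in [q ^ 2]. *)
Lemma bernoulli_cos (q s nu : R) : 0 <= q <= 1 -> `|s| <= 1 ->
  `|q * cos (nu + s * (1 - q)) + (1 - q) * cos (nu - s * q) -
    expR (- (s ^+ 2 / 2 * q)) * cos nu| <= `|s| ^+ 3 * q + s ^+ 2 * q ^+ 2.
Proof.
move=> /andP[q0 q1] s1.
have s2 : s ^+ 2 <= 1 by rewrite -real_normK ?num_real// expr_le1.
have a0 := normr_ge0 s; have s20 := sqr_ge0 s.
have h1 := cos_taylor3 (s * (1 - q)) nu; have h2 := cos_taylor3 (- (s * q)) nu.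
rewrite normrM exprMn (ger0_norm (_ : 0 <= 1 - q)) in h1; last by lra.
rewrite normrN normrM exprMn (ger0_norm q0) in h2.
rewrite ![nu + _]addrC.
have t0 : 0 <= s ^+ 2 / 2 * q by rewrite mulr_ge0// divr_ge0.
have h3 := expR_ge1Dx (- (s ^+ 2 / 2 * q)).
have h4 : expR (- (s ^+ 2 / 2 * q)) <= 1 - s ^+ 2 / 2 * q + 2 * (s ^+ 2 / 2 * q) ^+ 2.
  have := @expR_le_quad R (- (s ^+ 2 / 2 * q)); rewrite sqrrN; apply.
  by rewrite normrN ger0_norm//; nra.
have c1 := cos_max nu.
set T1 := _ - _ - _ in h1; set T2 := _ - _ - _ in h2.
have -> : q * cos (s * (1 - q) + nu) + (1 - q) * cos (- (s * q) + nu) -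
    expR (- (s ^+ 2 / 2 * q)) * cos nu =
  q * (cos (s * (1 - q) + nu) - T1) + (1 - q) * (cos (- (s * q) + nu) - T2) -
  (expR (- (s ^+ 2 / 2 * q)) - (1 - s ^+ 2 / 2 * (q * (1 - q)))) * cos nu.
  by rewrite /T1 /T2; field.
apply: (le_trans (ler_normB _ _)); apply: lerD.
  apply: (le_trans (ler_normD _ _)).
  rewrite !normrM (ger0_norm q0) (ger0_norm (_ : 0 <= 1 - q)); last by lra.
  apply: (le_trans (lerD (ler_wpM2l q0 h1) (ler_wpM2l (_ : 0 <= 1 - q) h2))); first lra.
  have A0 : 0 <= `|s| ^+ 3 by rewrite exprn_ge0.
  suff : 0 <= `|s| ^+ 3 * (q * (6 - (1 - q) ^+ 3 - (1 - q) * q ^+ 2)) by lra.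
  rewrite mulr_ge0// mulr_ge0//.
  have : (1 - q) ^+ 3 <= 1 by rewrite expr_le1//; lra.
  by nra.
rewrite normrM -[leRHS]mulr1 ler_pM//.
have u : 2 * (s ^+ 2 / 2 * q) ^+ 2 <= s ^+ 2 / 2 * q ^+ 2.
  rewrite (_ : 2 * _ = s ^+ 2 / 2 * q ^+ 2 * s ^+ 2); last by field.
  by rewrite ler_piMr// mulr_ge0 ?sqr_ge0// divr_ge0.
have v : 0 <= s ^+ 2 * q ^+ 2 by rewrite mulr_ge0// sqr_ge0.
by rewrite ler_norml; apply/andP; split; lra.
Qed.

(** Conditioning on one prime merely shifts the phase, so the induction runs over all [nu]. Gaussian
    factors are at most [1], hence the errors of the single primes add up. *)
Lemma model_cos l s nu : uniq l -> all prime l -> `|s| <= 1 ->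
  `|model l (fun k => cos (s * (k%:R - recips R l) + nu)) -
    expR (- (s ^+ 2 / 2 * recips R l)) * cos nu| <=
  `|s| ^+ 3 * recips R l + s ^+ 2 * \sum_(p <- l) (p%:R^-1 ^+ 2).
Proof.
move=> ul al s1; elim: l ul al nu => [|p l IH] /=.
  move=> _ _ nu; rewrite model_nil /recips !big_nil !mulr0 subr0 mulr0 oppr0 expR0.
  by rewrite mul1r add0r subrr normr0 addr0.
case/andP=> pl ul /andP[pp al] nu; rewrite model_cons// /recips !big_cons -/(recips R l).
set q : R := p%:R^-1.
have q01 : 0 <= q <= 1 by rewrite /q invr_ge0 ler0n invf_le1 ?ler1n ?ltr0n ?prime_gt0.
have [q0 q1] := andP q01.
have -> : model l (fun k => cos (s * (k.+1%:R - (q + recips R l)) + nu)) =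
    model l (fun k => cos (s * (k%:R - recips R l) + (nu + s * (1 - q)))) :> R.
  by apply: eq_avg => n _ /=; congr cos; rewrite -natr1; ring.
have -> : model l (fun k => cos (s * (k%:R - (q + recips R l)) + nu)) =
    model l (fun k => cos (s * (k%:R - recips R l) + (nu - s * q))) :> R.
  by apply: eq_avg => n _ /=; congr cos; ring.
have h1 := IH ul al (nu + s * (1 - q)); have h2 := IH ul al (nu - s * q).
have h3 := bernoulli_cos nu q01 s1.
move: h1 h2 h3; rewrite [s ^+ 2 / 2 * (q + _)]mulrDr opprD expRD.
set A := model l _; set B := model l _; set e := expR (- (_ * recips R l)).
set D := _ + _ * \sum_(_ <- _) _ => h1 h2 h3.
have e01 : 0 <= e <= 1.
  rewrite expR_ge0/= expR_le1 oppr_le0 mulr_ge0 ?divr_ge0 ?sqr_ge0//.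
  by apply: sumr_ge0 => i _; rewrite invr_ge0.
have [e0 e1] := andP e01.
set E := expR _ in h3 *.
have -> : q * A + (1 - q) * B - E * e * cos nu =
  q * (A - e * cos (nu + s * (1 - q))) + (1 - q) * (B - e * cos (nu - s * q)) +
  e * (q * cos (nu + s * (1 - q)) + (1 - q) * cos (nu - s * q) - E * cos nu) by ring.
apply: (@le_trans _ _ (D + (`|s| ^+ 3 * q + s ^+ 2 * q ^+ 2))); last first.
  by rewrite /D le_eqVlt; apply/orP; left; apply/eqP; ring.
apply: (le_trans (ler_normD _ _)); apply: lerD.
  apply: (le_trans (ler_normD _ _)); rewrite !normrM (ger0_norm q0).
  rewrite (ger0_norm (_ : 0 <= 1 - q)); last by lra.
  rewrite (_ : D = q * D + (1 - q) * D); last by ring.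
  by apply: lerD; rewrite ler_wpM2l//; lra.
by rewrite normrM (ger0_norm e0); apply: le_trans h3; rewrite ler_piMl.
Qed.

Lemma expR_norm_ge (x : R) k : (0 < k)%N ->
  x ^+ k.*2 / k.*2`!%:R <= expR x + expR (- x).
Proof.
move=> k0; have -> : x ^+ k.*2 = `|x| ^+ k.*2.
  by rewrite -mul2n !exprM real_normK ?num_real.
have := @expR_ge1Dxn R `|x| k.*2.-1 (normr_ge0 _).
rewrite prednK ?double_gt0// => h.
have h2 : expR `|x| <= expR x + expR (- x).
  by have [_|_] := ger0P x; rewrite ?lerDl ?lerDr expR_ge0.
lra.
Qed.

(** One term of the exponential series is bounded by the exponential moment taken at [2 * s]; the
    doubling is what gains [4 ^ k], and it explains the bound on [s]. *)
Lemma model_moment_le l s k : (0 < k)%N -> uniq l -> all prime l -> `|s| <= 2^-1 ->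
  model l (fun j => (s * (j%:R - recips R l)) ^+ k.*2 / k.*2`!%:R) <=
  2 * expR (8 * s ^+ 2 * recips R l) / 4 ^+ k.
Proof.
move=> k0 ul al s2.
have s1 : `|2 * s| <= 1 by rewrite normrM ger0_norm//; lra.
have s1' : `|- (2 * s)| <= 1 by rewrite normrN.
have h := model_expR ul al s1; have h' := model_expR ul al s1'.
rewrite sqrrN in h'.
rewrite (_ : 2 * (2 * s) ^+ 2 = 8 * s ^+ 2) in h h'; last by ring.
have e : 4 ^+ k * model l (fun j => (s * (j%:R - recips R l)) ^+ k.*2 / k.*2`!%:R) <=
    model l (fun k => expR (2 * s * (k%:R - recips R l))) +
    model l (fun k => expR (- (2 * s) * (k%:R - recips R l))).
  rewrite /model -avgZ -avgD; apply: le_avg => n _ /=.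
  have := expR_norm_ge (2 * s * ((ndiv l n)%:R - recips R l)) k0.
  rewrite mulNr; apply: le_trans.
  rewrite -[2 * s * _]mulrA [in leRHS]exprMn -mul2n [2 ^+ (2 * k)]exprM.
  by rewrite (_ : 2 ^+ 2 = 4 :> R) ?mulrA//; ring.
rewrite ler_pdivlMr ?exprn_gt0// mulrC.
by apply: (le_trans e); lra.
Qed.

End lindeberg.

(** * Transfer from the model to an interval *)

Section transfer.
Variable R : realType.
Variables (l : seq nat) (M : nat).
Hypotheses (M0 : (0 < M)%N) (ul : uniq l) (al : all prime l).
Implicit Types (s nu : R).

Let X n : R := (ndiv l n)%:R - recips R l.
(** It dominates [size l + recips R l], and it is at least [1] even for empty [l], so that its
    powers increase. *)
Let B : R := (size l).*2.+1%:R.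

Lemma recips_ge0 : 0 <= recips R l.
Proof. by apply: sumr_ge0 => p _; rewrite invr_ge0. Qed.

Lemma recips_le_size : recips R l <= (size l)%:R.
Proof.
rewrite /recips -sum1_size natr_sum big_seq [leRHS]big_seq ler_sum// => p /(allP al) pp.
by rewrite invf_le1 ?ler1n ?ltr0n prime_gt0.
Qed.

Lemma moment_error j :
  `|avg M (fun n => X n ^+ j) - model l (fun i => (i%:R - recips R l) ^+ j)| <= B ^+ j / M%:R.
Proof.
have D0 := prod_primes_gt0 al.
have lD : all (dvdn^~ (\prod_(p <- l) p)%N) l by apply/allP => p; exact: dvdn_prod_seq.
have := moment_match (recips R l) M0 D0 lD j (dvd1n _).
have e K : avg K (fun n => ((ndiv l n)%:R - recips R l) ^+ j * (1 %| n)%:R) =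
           avg K (fun n => X n ^+ j).
  by apply: eq_avg => n _; rewrite dvd1n mulr1.
rewrite !e => /le_trans; apply; rewrite ler_wpM2r ?invr_ge0//.
rewrite lerXn2r ?nnegrE ?addr_ge0// (ger0_norm recips_ge0) /B -addnn -natr1 natrD.
by have := recips_le_size; lra.
Qed.

Lemma avg_sqr_le s : 0 < `|s| <= 2^-1 ->
  avg M (fun n => X n ^+ 2) <= expR (8 * s ^+ 2 * recips R l) / s ^+ 2 + B ^+ 2 / M%:R.
Proof.
move=> /andP[s0 s2]; have := moment_error 2; rewrite ler_norml => /andP[_].
rewrite lerBlDr => /le_trans; apply; rewrite addrC lerD2r.
have ss : 0 < s ^+ 2 by rewrite exprn_even_gt0// -normr_gt0 s0.
rewrite ler_pdivlMr//.
have := @model_moment_le R l s 1 isT ul al s2; rewrite expr1 (_ : 1.*2`! = 2)%N//.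
have -> : model l (fun j => (s * (j%:R - recips R l)) ^+ 1.*2 / 2%:R) =
    2^-1 * s ^+ 2 * model l (fun i => (i%:R - recips R l) ^+ 2).
  by rewrite /model -avgZ; apply: eq_avg => n _ /=; rewrite exprMn; ring.
by move=> h; lra.
Qed.

(** The cosine is replaced by its Taylor polynomial on both sides. Of the [2 * k + 1] moment errors,
    [2 * k] come from the terms of the polynomial and one from moving the remainder on the interval
    to the model; the two remainders together give the factor [4]. *)
Lemma avg_cos_approx s nu k : (0 < k)%N -> `|s| <= 2^-1 ->
  `|avg M (fun n => cos (s * X n + nu)) -
    expR (- (s ^+ 2 / 2 * recips R l)) * cos nu| <=
  k.*2.+1%:R * B ^+ k.*2 / M%:R + 4 * expR (8 * s ^+ 2 * recips R l) / 4 ^+ k +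
  (`|s| ^+ 3 * recips R l + s ^+ 2 * \sum_(p <- l) (p%:R^-1 ^+ 2)).
Proof.
move=> k0 s2; have s1 : `|s| <= 1 by apply: le_trans s2 _; rewrite invf_le1// ler1n.
have B1 : 1 <= B by rewrite ler1n.
set G := model l (fun i => cos (s * (i%:R - recips R l) + nu)).
set P := cos_taylor k.*2 nu.
set mu := recips R l.
have hG := model_cos nu ul al s1.
have MV0 : 0 <= M%:R^-1 :> R by rewrite invr_ge0.
have e2k (z : R) : 0 <= z ^+ k.*2 by rewrite -mul2n exprM exprn_ge0// sqr_ge0.
have tay (K : nat) : `|avg K (fun n => cos (s * X n + nu)) - avg K (fun n => P.[s * X n])| <=
    s ^+ k.*2 / k.*2`!%:R * avg K (fun n => X n ^+ k.*2).
  apply: (le_trans (ler_dist_avg _ _ _)); rewrite -avgZ; apply: le_avg => n _.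
  apply: (le_trans (cos_taylor_bound _ _ _)).
  by rewrite -normrX (ger0_norm (e2k _)) exprMn mulrAC.
have hk := model_moment_le k0 ul al s2.
have hk' : s ^+ k.*2 / k.*2`!%:R * model l (fun i => (i%:R - mu) ^+ k.*2) <=
    2 * expR (8 * s ^+ 2 * mu) / 4 ^+ k.
  apply: le_trans hk; rewrite /model -avgZ; apply: le_avg => n _ /=.
  by rewrite exprMn mulrAC.
have c0 : 0 <= s ^+ k.*2 / k.*2`!%:R <= 1.
  rewrite divr_ge0//= ler_pdivrMr ?ltr0n ?fact_gt0// mul1r (@le_trans _ _ 1)//.
    by rewrite -(ger0_norm (e2k s)) normrX exprn_ile1.
  by rewrite ler1n fact_gt0.
have [c00 c01] := andP c0.
(* The model is itself an average over an interval, namely a full period, so [tay] applies to it as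
   well. *)
have tM := tay M; have tD := tay (\prod_(p <- l) p)%N.
have mom : `|avg M (fun n => P.[s * X n]) - model l (fun i => P.[s * (i%:R - mu)])| <=
    k.*2%:R * B ^+ k.*2 / M%:R.
  have E K : avg K (fun n => P.[s * X n]) =
      \sum_(j < k.*2) cos (nu + j%:R * (pi / 2)) / j`!%:R * s ^+ j * avg K (fun n => X n ^+ j).
    rewrite (eq_avg (g := fun n => \sum_(j < k.*2)
      (cos (nu + j%:R * (pi / 2)) / j`!%:R * s ^+ j * X n ^+ j))).
      by rewrite avg_sum; apply: eq_bigr => j _; rewrite avgZ.
    by move=> n _; rewrite horner_poly; apply: eq_bigr => j _; rewrite exprMn [LHS]mulrA.
  rewrite (E M) [model _ _]E -sumrB; apply: (le_trans (ler_norm_sum _ _ _)).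
  have -> : k.*2%:R * B ^+ k.*2 / M%:R = \sum_(j < k.*2) (B ^+ k.*2 / M%:R).
    by rewrite sumr_const card_ord -mulrA mulr_natl.
  apply: ler_sum => j _; rewrite -mulrBr normrM.
  apply: (@le_trans _ _ (1 * (B ^+ j / M%:R))).
    apply: ler_pM => //; last exact: moment_error.
    rewrite !normrM normrX mulr_ile1 ?mulr_ge0 ?exprn_ile1//.
    rewrite mulr_ile1 ?cos_max// ger0_norm ?invr_ge0//.
    by rewrite invf_le1 ?ler1n ?ltr0n fact_gt0.
  by rewrite mul1r ler_wpM2r// ler_weXn2l// ltnW.
have mk := moment_error k.*2; rewrite -/mu in mk.
have hM : s ^+ k.*2 / k.*2`!%:R * avg M (fun n => X n ^+ k.*2) <=
    2 * expR (8 * s ^+ 2 * mu) / 4 ^+ k + B ^+ k.*2 / M%:R.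
  move: mk; rewrite ler_norml => /andP[_]; rewrite lerBlDl => mk.
  apply: (le_trans (ler_wpM2l c00 mk)); rewrite mulrDr lerD//.
  by rewrite ler_piMl// divr_ge0// exprn_ge0// (le_trans _ B1).
rewrite -/G in hG.
have tD' : `|G - model l (fun i => P.[s * (i%:R - mu)])| <= 2 * expR (8 * s ^+ 2 * mu) / 4 ^+ k.
  exact: le_trans tD hk'.
have {hM}tM' := le_trans tM hM.
apply: (le_trans (ler_distD G _ _)).
apply: lerD => //.
apply: (le_trans (ler_distD (avg M (fun n => P.[s * X n])) _ _)).
have := ler_distD (model l (fun i => P.[s * (i%:R - mu)])) (avg M (fun n => P.[s * X n])) G.
rewrite [in X in _ <= _ + X]distrC.
rewrite -[k.*2%:R * _ / _]mulrA in mom; rewrite -[2 * _ / _]mulrA in tM' tD'.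
rewrite -[k.*2.+1%:R]natr1 [(_ + 1) * _]mulrDl [(_ + _) / M%:R]mulrDl mul1r -[k.*2%:R * _ / _]mulrA -[4 * _ / _]mulrA.
move: (B ^+ _ / _) (expR _ / _) `|avg M _ - avg M _| `|avg M _ - G| `|G - _| `|_ - model l _| mom tM' tD'.
by move=> e g a b c d ? ? ? ?; lra.
Qed.

End transfer.

(** * Truncation of [omega1] *)

Definition prime_seq (z : nat) : seq nat := [seq p <- index_iota 1 z.+1 | prime p].

Lemma prime_seq_uniq z : uniq (prime_seq z).
Proof. by rewrite filter_uniq ?iota_uniq. Qed.

Lemma prime_seq_prime z : all prime (prime_seq z).
Proof. by apply/allP => p; rewrite mem_filter => /andP[]. Qed.

Lemma mem_prime_seq z p : (p \in prime_seq z) = prime p && (p <= z)%N.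
Proof.
rewrite mem_filter mem_index_iota ltnS; case: (boolP (prime p)) => //= pp.
by rewrite prime_gt0.
Qed.

Lemma size_prime_seq z : (size (prime_seq z) <= z)%N.
Proof. by rewrite size_filter (leq_trans (count_size _ _))// size_iota subn1. Qed.

Lemma ndiv_prime_seq z n : (0 < n)%N ->
  ndiv (prime_seq z) n = count (fun p => p <= z)%N (primes n).
Proof.
move=> n0; rewrite /ndiv -!size_filter; apply: perm_size; apply: uniq_perm.
- by rewrite filter_uniq// prime_seq_uniq.
- by rewrite filter_uniq// primes_uniq.
move=> p; rewrite mem_filter mem_prime_seq mem_filter mem_primes n0 andTb.
by case: (p %| n)%N; case: (prime p) => //=; rewrite ?andbT ?andbF.
Qed.

Definition nsqdiv (n : nat) : nat := count (fun p => p ^ 2 %| n)%N (primes n).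

(** The product of these primes divides [n], and each of them is at least [z + 1]. *)
Lemma count_large_primes z m n : (0 < n)%N -> (n < z.+1 ^ m)%N ->
  (count (fun p => z < p)%N (primes n) <= m)%N.
Proof.
move=> n0 nz; set s := [seq p <- primes n | z < p]%N.
have sn : (\prod_(p <- s) p <= n)%N.
  apply: dvdn_leq => //; apply: prod_primes_dvdn.
  - by rewrite filter_uniq// primes_uniq.
  - by apply/allP => p; rewrite mem_filter mem_primes => /and3P[].
  - by apply/allP => p; rewrite mem_filter mem_primes => /and4P[].
have zs : (z.+1 ^ size s <= \prod_(p <- s) p)%N.
  have: all (fun p => z < p)%N s by apply/allP => p; rewrite mem_filter => /andP[].
  elim: s {sn} => [|p s IH] /=; first by rewrite big_nil.
  by move=> /andP[zp /IH h]; rewrite big_cons expnS leq_mul.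
rewrite -size_filter -/s -(@leq_exp2l z.+1).
  by apply: ltnW; apply: leq_ltn_trans nz; apply: leq_trans sn.
case: z nz s sn zs => // ; rewrite exp1n; lia.
Qed.

Lemma omega1_near_ndiv (R : realType) z m n : (0 < n)%N -> (n < z.+1 ^ m)%N ->
  `|(omega1 n)%:R - (ndiv (prime_seq z) n)%:R| <= m%:R + (nsqdiv n)%:R :> R.
Proof.
move=> n0 nz; have := count_large_primes n0 nz.
rewrite ndiv_prime_seq// /omega1 /nsqdiv size_filter => h.
have e1 := count_predC (fun p => p ^ 2 %| n)%N (primes n).
have e2 := count_predC (fun p => p <= z)%N (primes n).
have e3 : count (predC (leq^~ z)) (primes n) = count (fun p => z < p)%N (primes n).
  by apply: eq_count => p /=; rewrite ltnNge.
rewrite e3 in e2.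
rewrite /predC/= in e1.
have e1' : (count (fun p => p ^ 2 %| n)%N (primes n))%:R +
    (count (fun p => ~~ (p ^ 2 %| n)%N) (primes n))%:R = (size (primes n))%:R :> R.
  by rewrite -natrD e1.
have e2' : (count (fun p => p <= z)%N (primes n))%:R +
    (count (fun p => z < p)%N (primes n))%:R = (size (primes n))%:R :> R.
  by rewrite -natrD e2.
have h' : (count (fun p => z < p)%N (primes n))%:R <= m%:R :> R by rewrite ler_nat.
move: e1' e2' h'; move: (count _ _) (count _ _) (count _ _) (count _ _) => a b c d.
have := ler0n R a; have := ler0n R d.
by rewrite ler_norml => *; apply/andP; split; lra.
Qed.

Lemma divn_half K N : (0 < K)%N -> (2 * K <= N)%N ->
  (0 < N %/ K)%N /\ (N <= 2 * K * (N %/ K))%N.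
Proof.
move=> K0 KN; have M0 : (0 < N %/ K)%N by rewrite divn_gt0//; lia.
split=> //; have := ltn_ceil N K0; move: (N %/ K)%N M0 => M M0 h.
by rewrite -mulnA mul2n -addnn; rewrite mulSn in h; nia.
Qed.

(** * Limits of averages over all integers *)

Section asymptotics.
Variable R : realType.

Lemma sum_inv_sqr_le z : \sum_(p <- prime_seq z) (p%:R^-1 ^+ 2) <= 1 :> R.
Proof.
rewrite big_filter sum_primeE; apply: le_trans (sum_prime_le _ _) _.
  by move=> k _; rewrite sqr_ge0.
(* The term [- 1 / z] is the telescoping surplus that makes the induction work. *)
apply: (@le_trans _ _ (1 - z%:R^-1)); last by rewrite gerBl invr_ge0.
elim: z => [|z IH]; first by rewrite big_geq// invr0 subr0.
case: (posnP z) => [->|z0]; first by rewrite big_geq// invr1 subrr.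
rewrite big_nat_recr//=; apply: (le_trans (lerD IH (lexx _))).
rewrite -[z.+1%:R]natr1; set x : R := z%:R.
have x0 : 0 < x by rewrite ltr0n.
rewrite -subr_ge0.
have -> : 1 - (x + 1)^-1 - (1 - x^-1 + (x + 1)^-1 ^+ 2) = (x * (x + 1) ^+ 2)^-1.
  by field; rewrite !gt_eqF//; lra.
by rewrite invr_ge0 mulr_ge0 ?sqr_ge0// ltW.
Qed.

Lemma avg_nsqdiv_le M : avg M (fun n => (nsqdiv n)%:R) <= 1 :> R.
Proof.
have [->|M0] := posnP M; first by rewrite /avg big_geq// mul0r.
have MR : 0 < M%:R :> R by rewrite ltr0n.
apply: le_trans (sum_inv_sqr_le M).
apply: (@le_trans _ _ (avg M (fun n => \sum_(p <- prime_seq M) (p ^ 2 %| n)%:R))).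
  apply: le_avg => n /andP[n0 nM].
  rewrite -natr_sum ler_nat /nsqdiv -sum1_count -big_filter sum1_size.
  rewrite -big_mkcond sum1_count -size_filter; apply: uniq_leq_size.
    by rewrite filter_uniq// primes_uniq.
  move=> p; rewrite !mem_filter mem_primes => /and4P[p2 pp _ pn].
  rewrite p2 pp mem_index_iota prime_gt0//= ltnS.
  by rewrite (leq_trans _ nM)// dvdn_leq.
rewrite avg_sum big_seq [leRHS]big_seq; apply: ler_sum => p.
rewrite mem_prime_seq => /andP[pp _]; have p0 := prime_gt0 pp.
have pR : 0 < p%:R :> R by rewrite ltr0n.
rewrite /avg; under eq_bigr do rewrite -[(_ %| _)%:R]mulr1.
rewrite (sum_multiples (fun=> 1)) ?expn_gt0 ?p0// sumr_const_nat subn1/=.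
rewrite ler_pdivrMr// exprVn mulrC ler_pdivlMr ?exprn_gt0// -natrX -natrM ler_nat.
exact: leq_trunc_div.
Qed.

Definition LL (N : nat) : R := ln (ln N%:R).

Lemma near_LL (A : R) : \forall N \near \oo, A <= LL N.
Proof.
have : \forall N \near \oo, expR (expR A) <= N%:R.
  near=> N; near: N; exact: nbhs_infty_ger.
apply: filterS => N h.
have N0 : 0 < N%:R :> R by apply: lt_le_trans h; rewrite expR_gt0.
rewrite /LL -[A]expRK ler_ln ?posrE ?expR_gt0//.
  by rewrite -[expR A]expRK ler_ln ?posrE ?expR_gt0//.
by rewrite ln_gt0// (lt_le_trans _ h)// expR_gt1 expR_gt0.
Unshelve. all: by end_near. Qed.

(** The integer part of the [m]-th root: it serves as truncation point with [m = 4 * k], and with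
    [m = 2] to count small integers. *)
Lemma root_exists m N : (0 < m)%N -> (0 < N)%N ->
  exists z, (0 < z)%N && (z ^ m <= N < z.+1 ^ m)%N.
Proof.
move=> m0; elim: N => // N IH _; case: (posnP N) => [->|N0].
  by exists 1%N; rewrite exp1n/= (leq_ltn_trans m0)// ltn_expl.
have [z /and3P[z0 zN Nz]] := IH N0.
case: (ltnP N.+1 (z.+1 ^ m)) => h; first by exists z; rewrite z0 h (leq_trans zN).
exists z.+1; rewrite h/=; apply: (@leq_ltn_trans (z.+1 ^ m)) => //.
by rewrite ltn_exp2r.
Qed.

Definition WN (N n : nat) : R := ((omega1 n)%:R - LL N) / Num.sqrt (LL N).

Lemma expR_dist_le (a b : R) : 0 <= a -> 0 <= b -> `|expR (- a) - expR (- b)| <= `|a - b|.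
Proof.
wlog ab : a b / a <= b.
  move=> H a0 b0; have [/H|/ltW/H] := leP a b; first exact.
  by move=> h; rewrite distrC [ `|a - b| ]distrC; exact: h.
move=> a0 b0.
have ha : expR (- a) <= 1 by rewrite expR_le1 oppr_le0.
have h := expR_ge1Dx (a - b).
have e : expR (- b) = expR (- a) * expR (a - b) by rewrite -expRD; congr expR; ring.
have pa := expR_gt0 (- a).
rewrite ger0_norm ?subr_ge0 ?ler_expR ?lerN2// ler0_norm ?subr_le0// e.
by nra.
Qed.

(* Truncation at [z ~ N ^ (1 / 4k)] costs only [O_k(1)] in [omega1] and in the
   mean, so it is negligible after division by [sqrt (LL N)]. *)
Lemma truncation (k : nat) : (0 < k)%N -> exists C : R, 0 < C /\
  \forall N \near \oo, exists z : nat,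
    [/\ (z ^ (4 * k) <= N)%N, (0 < z)%N, `|recips R (prime_seq z) - LL N| <= C &
     forall M, (M <= N)%N -> avg M (fun n =>
       `|(omega1 n)%:R - LL N - ((ndiv (prime_seq z) n)%:R - recips R (prime_seq z))|) <= C].
Proof.
move=> k0; have [C hC] := mertens2 R.
(* [C] is the constant of the second theorem of Mertens; [ln (8 * k)] bounds [LL N - ln (ln z)],
   because [N < (z + 1) ^ (4 * k) <= z ^ (8 * k)]. *)
pose C1 := C + ln (8 * k)%:R.
have C10 : 0 <= C1.
  rewrite addr_ge0 ?ln_nat_ge0//; have := hC 2 isT; exact: le_trans.
(* [4 * k] bounds the number of prime divisors above [z], and the remaining [1] the average number
   of primes whose square divides [n]. *)
exists (C1 + (4 * k).+1%:R); split; first by rewrite ltr_wpDl.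
near=> N; have N4 : (2 ^ (4 * k) <= N)%N by near: N; exact: nbhs_infty_ge.
have N0 : (0 < N)%N by apply: leq_trans N4; rewrite expn_gt0.
have [z /and3P[z0 zN Nz]] := @root_exists (4 * k) N (ltac:(lia)) N0.
have z2 : (1 < z)%N.
  by rewrite -ltnS -(@ltn_exp2r _ _ (4 * k)); [apply: leq_ltn_trans Nz|lia].
have rE : recips R (prime_seq z) = prime_recip_sum R z by rewrite /recips big_filter.
have lz0 : 0 < ln z%:R :> R by rewrite ln_gt0// ltr1n.
have lN0 : 0 < ln N%:R :> R.
  rewrite ln_gt0// ltr1n (leq_trans _ N4)//.
  by have := @ltn_expl 2 (4 * k) isT; lia.
have up : ln z%:R <= ln N%:R :> R.
  rewrite ler_ln ?posrE ?ltr0n// ler_nat (leq_trans _ zN)// -[X in (X <= _)%N]expn1.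
  rewrite leq_exp2l//; lia.
have lo : ln N%:R <= (8 * k)%:R * ln z%:R :> R.
  rewrite mulrC mulr_natr -lnXn ?ltr0n// -natrX ler_ln ?posrE ?ltr0n ?expn_gt0 ?z0//.
  rewrite ler_nat (leq_trans (ltnW Nz))// (_ : 8 * k = 2 * (4 * k))%N; last by lia.
  rewrite [(z ^ (2 * _))%N]expnM leq_exp2r; last by lia.
  by rewrite -mulnn; nia.
have LLd : `|ln (ln z%:R) - LL N| <= ln (8 * k)%:R.
  have h1 : ln (ln z%:R) <= LL N by rewrite ler_ln ?posrE.
  have h2 : LL N <= ln (8 * k)%:R + ln (ln z%:R).
    rewrite -lnM ?posrE ?ltr0n//; last by lia.
    by rewrite ler_ln ?posrE// mulr_gt0// ltr0n; lia.
  by rewrite ler_norml; apply/andP; split; have := ln_nat_ge0 R (8 * k); lra.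
have muL : `|recips R (prime_seq z) - LL N| <= C1.
  apply: (le_trans (ler_distD (ln (ln z%:R)) _ _)); apply: lerD => //.
  by rewrite rE hC.
exists z; split => //; first by rewrite (le_trans muL)// lerDl.
move=> M MN; have [->|M0] := posnP M.
  by rewrite /avg big_geq// mul0r addr_ge0.
apply: (@le_trans _ _ (avg M (fun n => (C1 + (4 * k)%:R) + (nsqdiv n)%:R))).
  apply: le_avg => n /andP[n0 nM].
  have nz : (n < z.+1 ^ (4 * k))%N by rewrite (leq_ltn_trans _ Nz)// (leq_trans nM).
  have := omega1_near_ndiv R n0 nz; move: muL; rewrite !ler_norml.
  by move=> /andP[? ?] /andP[? ?]; apply/andP; split; lra.
rewrite avgD avg_cst// -[(4 * k).+1%:R]natr1 addrA lerD2l.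
exact: avg_nsqdiv_le.
Unshelve. all: by end_near. Qed.

Lemma cos_lipschitz (x y : R) : `|cos x - cos y| <= `|x - y|.
Proof.
have := cos_taylor_bound 1 y (x - y); rewrite subrK expr1 (_ : 1`! = 1)%N// divr1.
by rewrite horner_poly big_ord1 mul0r addr0 fact0 divr1 expr0 mulr1.
Qed.

Lemma LL_le N : 1 <= LL N -> LL N <= N%:R.
Proof.
move=> h; have l0 : 0 < ln N%:R :> R.
  by rewrite ltNge; apply/negP => l0; move: h; rewrite /LL ln0//; lra.
have N0 : 0 < N%:R :> R.
  by rewrite ltNge; apply/negP => N0; move: l0; rewrite ln0// ltxx.
by have := ln_sublinear l0; have := ln_sublinear N0; rewrite /LL; lra.
Qed.

Lemma size_prime_seq_pow z k : (0 < z)%N ->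
  (size (prime_seq z)).*2.+1%:R ^+ k.*2 <= 9 ^+ k * z%:R ^+ k.*2 :> R.
Proof.
move=> z0; rewrite -[k.*2]mul2n ![_ ^+ (2 * k)]exprM -exprMn lerXn2r ?nnegrE ?mulr_ge0 ?exprn_ge0//.
rewrite (_ : 9 = 3 ^+ 2); last by ring.
rewrite -exprMn lerXn2r ?nnegrE ?mulr_ge0// -natrM ler_nat.
by have := size_prime_seq z; lia.
Qed.

(** The range ends at [N / K] while the normalisation is that of [N]: this is the form needed later
    for multiples of [K]. The last term does not vanish as [N] grows and is left to the choice of
    [k]. *)
Lemma avg_cos_WN_approx (lam nu : R) (K k : nat) : (0 < K)%N -> (0 < k)%N ->
  exists A : R, \forall N \near \oo,
  `|avg (N %/ K) (fun n => cos (lam * WN N n + nu)) - expR (- (lam ^+ 2 / 2)) * cos nu| <=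
  A / Num.sqrt (LL N) + 4 * expR (16 * lam ^+ 2) / 4 ^+ k.
Proof.
move=> K0 k0; have [C [C0 hC]] := truncation k0.
have k4 : (k.*2 * 2 = 4 * k)%N by lia.
(* In this order: truncation of [omega1], replacement of [mu] by [LL N] in the Gaussian exponent,
   transfer of moments, then the cubic term and the [1 / p ^ 2] term of the model. *)
exists (`|lam| * C + lam ^+ 2 / 2 * C + k.*2.+1%:R * (9 ^+ k * (2 * K%:R)) +
  2 * `|lam| ^+ 3 + lam ^+ 2).
near=> N.
have L1 : 1 <= LL N by near: N; exact: near_LL.
have LC : C <= LL N by near: N; exact: near_LL.
have Llam : 4 * lam ^+ 2 <= LL N by near: N; exact: near_LL.
have N2K : (2 * K <= N)%N by near: N; exact: nbhs_infty_ge.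
have [z [zN z0 muL hz]] : exists z : nat,
    [/\ (z ^ (4 * k) <= N)%N, (0 < z)%N, `|recips R (prime_seq z) - LL N| <= C &
     forall M, (M <= N)%N -> avg M (fun n =>
       `|(omega1 n)%:R - LL N - ((ndiv (prime_seq z) n)%:R - recips R (prime_seq z))|) <= C].
  by near: N.
set T := Num.sqrt (LL N); set mu := recips R (prime_seq z).
have TT : T ^+ 2 = LL N by rewrite sqr_sqrtr//; lra.
have T1 : 1 <= T by rewrite -[1]sqrtr1 ler_sqrt//; lra.
have T0 : 0 < T by lra.
have mu0 : 0 <= mu by exact: recips_ge0.
have mu2 : mu <= 2 * T ^+ 2.
  by move: muL; rewrite ler_norml TT => /andP[_]; rewrite -/mu; lra.
set s := lam / T.
have sn : `|s| = `|lam| / T by rewrite normrM normfV (ger0_norm (ltW T0)).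
have ss : s ^+ 2 = lam ^+ 2 / T ^+ 2 by rewrite exprMn exprVn.
have s2 : `|s| <= 2^-1.
  have l0 := normr_ge0 lam; rewrite sn ler_pdivrMr//.
  rewrite -ler_sqr ?nnegrE ?mulr_ge0 ?(ltW T0)// exprMn TT real_normK ?num_real//.
  by rewrite exprVn; lra.
set M := (N %/ K)%N.
have [M0 MK0] := divn_half K0 N2K; rewrite -/M in M0 MK0.
have MN : (M <= N)%N by exact: leq_div.
have MR : 0 < M%:R :> R by rewrite ltr0n.
have MK : N%:R <= 2 * K%:R * M%:R :> R.
  by rewrite -!natrM ler_nat.
have a1 : `|avg M (fun n => cos (lam * WN N n + nu)) -
   avg M (fun n => cos (s * ((ndiv (prime_seq z) n)%:R - mu) + nu))| <= `|lam| * C / T.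
  apply: (le_trans (ler_dist_avg _ _ _)).
  rewrite mulrAC -sn; apply: le_trans (ler_wpM2l (normr_ge0 _) (hz M MN)).
  rewrite -avgZ; apply: le_avg => n _; apply: (le_trans (cos_lipschitz _ _)).
  rewrite -normrM le_eqVlt; apply/orP; left; apply/eqP; congr `|_|.
  by rewrite /WN -/T /s -/mu; field; rewrite gt_eqF.
have a2 := avg_cos_approx M0 (prime_seq_uniq z) (prime_seq_prime z) nu k0 s2.
rewrite -/mu in a2.
have smu : s ^+ 2 * mu <= 2 * lam ^+ 2.
  rewrite ss mulrAC ler_pdivrMr ?exprn_gt0//.
  by have := ler_wpM2l (sqr_ge0 lam) mu2; lra.
have a3 : 4 * expR (8 * s ^+ 2 * mu) / 4 ^+ k <= 4 * expR (16 * lam ^+ 2) / 4 ^+ k.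
  rewrite ler_wpM2r ?invr_ge0 ?exprn_ge0// ler_wpM2l// ler_expR; lra.
have a4 : `|s| ^+ 3 * mu <= 2 * `|lam| ^+ 3 / T.
  have -> : `|s| ^+ 3 = `|lam| ^+ 3 / T / T ^+ 2 by rewrite sn; field; rewrite gt_eqF.
  rewrite mulrAC ler_pdivrMr ?exprn_gt0//.
  have l3 : 0 <= `|lam| ^+ 3 / T by rewrite divr_ge0 ?exprn_ge0// ltW.
  by have := ler_wpM2l l3 mu2; lra.
have a5 : s ^+ 2 * \sum_(p <- prime_seq z) (p%:R^-1 ^+ 2) <= lam ^+ 2 / T.
  apply: (@le_trans _ _ (s ^+ 2 * 1)).
    by rewrite ler_wpM2l ?sqr_ge0// sum_inv_sqr_le.
  rewrite mulr1 ss ler_wpM2l ?sqr_ge0// lef_pV2 ?posrE ?exprn_gt0//.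
  by rewrite expr2 ler_peMl// ltW.
have a6 : `|expR (- (s ^+ 2 / 2 * mu)) * cos nu - expR (- (lam ^+ 2 / 2)) * cos nu| <=
    lam ^+ 2 / 2 * C / T.
  rewrite -mulrBl normrM; apply: (@le_trans _ _ (`|s ^+ 2 / 2 * mu - lam ^+ 2 / 2| * 1)).
    apply: ler_pM; rewrite ?cos_max// expR_dist_le//.
      by rewrite mulr_ge0// divr_ge0 ?sqr_ge0.
    by rewrite divr_ge0 ?sqr_ge0.
  rewrite mulr1.
  have -> : s ^+ 2 / 2 * mu - lam ^+ 2 / 2 = lam ^+ 2 / 2 * (mu - LL N) / T ^+ 2.
    by rewrite ss -TT; field; rewrite gt_eqF.
  rewrite normrM normfV [ `|T ^+ 2| ]ger0_norm ?sqr_ge0// normrM (ger0_norm (_ : 0 <= _ / 2)); last first.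
    by rewrite divr_ge0 ?sqr_ge0.
  apply: ler_pM.
  - by rewrite mulr_ge0// divr_ge0 ?sqr_ge0.
  - by rewrite invr_ge0 sqr_ge0.
  - by rewrite ler_wpM2l// divr_ge0// sqr_ge0.
  by rewrite lef_pV2 ?posrE ?exprn_gt0// expr2 ler_peMl// ltW.
have a7 : k.*2.+1%:R * (size (prime_seq z)).*2.+1%:R ^+ k.*2 / M%:R <=
    k.*2.+1%:R * (9 ^+ k * (2 * K%:R)) / T.
  rewrite -!mulrA ler_wpM2l// ler_pdivrMr// mulrA.
  apply: (le_trans (size_prime_seq_pow k z0)); rewrite -!mulrA ler_wpM2l ?exprn_ge0//.
  rewrite [T^-1 * _]mulrC !mulrA ler_pdivlMr//.
  apply: le_trans MK.
  (* Both [z ^ (2 * k)] and [T] are at most [sqrt N], so their product is at most [N]. *)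
  set y := z%:R ^+ _.
  have yN : y ^+ 2 <= N%:R :> R.
    by rewrite /y -exprM k4 -natrX ler_nat.
  have := LL_le L1; rewrite -TT => TN.
  by have := sqr_ge0 (y - T); rewrite sqrrB; lra.
set F := avg M _ in a1 *; set G := avg M _ in a1 a2.
set E := expR _ * _ in a2 a6; set E' := expR _ * _ in a6 *.
have tri : `|F - E'| <= `|F - G| + (`|G - E| + `|E - E'|).
  apply: (le_trans (ler_distD G _ _)); rewrite lerD2l; exact: ler_distD.
apply: (le_trans tri); move: a1 a2 a3 a4 a5 a6 a7 {tri}.
move: `|F - G| `|G - E| `|E - E'| => t1 t2 t3.
rewrite (_ : (_ + _ + _ + _ + _) / T = `|lam| * C / T + lam ^+ 2 / 2 * C / T +
  k.*2.+1%:R * (9 ^+ k * (2 * K%:R)) / T + 2 * `|lam| ^+ 3 / T + lam ^+ 2 / T); last by ring.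
move: (`|lam| * C / T) (lam ^+ 2 / 2 * C / T) (k.*2.+1%:R * (9 ^+ k * (2 * K%:R)) / T).
move: (2 * `|lam| ^+ 3 / T) (lam ^+ 2 / T) (4 * expR (16 * lam ^+ 2) / 4 ^+ k).
move: (_ / M%:R) (4 * expR (8 * s ^+ 2 * mu) / 4 ^+ k) (`|s| ^+ 3 * mu) (s ^+ 2 * _) => *; lra.
Unshelve. all: by end_near. Qed.

(** Tightness: the truncated count has second moment [O(LL N)] by the moment bound with [k = 1], and
    [|x| <= 1 + x ^ 2] turns this into a first moment. *)
Lemma avg_abs_WN_bounded : exists A : R, \forall N \near \oo,
  avg N (fun n => `|WN N n|) <= A.
Proof.
have [C [C0 hC]] := @truncation 1 isT.
(* [1] from [|x| <= 1 + x ^ 2], [4 * expR 4 + 9] from the second moment, and [C] from the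
   truncation. *)
exists (10 + 4 * expR 4 + C).
near=> N.
have L1 : 1 <= LL N by near: N; exact: near_LL.
have LC : C <= LL N by near: N; exact: near_LL.
have N0 : (0 < N)%N by near: N; exact: nbhs_infty_gt.
have [z [zN z0 muL hz]] : exists z : nat,
    [/\ (z ^ (4 * 1) <= N)%N, (0 < z)%N, `|recips R (prime_seq z) - LL N| <= C &
     forall M, (M <= N)%N -> avg M (fun n =>
       `|(omega1 n)%:R - LL N - ((ndiv (prime_seq z) n)%:R - recips R (prime_seq z))|) <= C].
  by near: N.
set T := Num.sqrt (LL N); set mu := recips R (prime_seq z).
have TT : T ^+ 2 = LL N by rewrite sqr_sqrtr//; lra.
have T1 : 1 <= T by rewrite -[1]sqrtr1 ler_sqrt//; lra.
have T0 : 0 < T by lra.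
have mu2 : mu <= 2 * T ^+ 2.
  by move: muL; rewrite ler_norml TT => /andP[_]; rewrite -/mu; lra.
have NR : 0 < N%:R :> R by rewrite ltr0n.
(* Then [|s| <= 1 / 2] because [T >= 1], and the exponent [8 * s ^ 2 * mu] is at most [4]. *)
pose s := (2 * T)^-1.
have s0 : 0 < s by rewrite invr_gt0 mulr_gt0.
have s2 : 0 < `|s| <= 2^-1.
  by rewrite gtr0_norm// s0 lef_pV2 ?posrE ?mulr_gt0//; lra.
have := avg_sqr_le N0 (prime_seq_uniq z) (prime_seq_prime z) s2.
rewrite -/mu => h.
have e1 : expR (8 * s ^+ 2 * mu) <= expR 4.
  have -> : s ^+ 2 = (4 * T ^+ 2)^-1 by rewrite /s; field; rewrite gt_eqF.
  rewrite ler_expR mulrAC ler_pdivrMr ?mulr_gt0 ?exprn_gt0//; lra.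
have e2 : expR (8 * s ^+ 2 * mu) / s ^+ 2 <= 4 * expR 4 * T ^+ 2.
  have -> : (s ^+ 2)^-1 = 4 * T ^+ 2 by rewrite /s; field; rewrite gt_eqF.
  by have := ler_wpM2r (sqr_ge0 T) e1; lra.
have e3 : (size (prime_seq z)).*2.+1%:R ^+ 2 / N%:R <= 9 :> R.
  rewrite ler_pdivrMr//; apply: (le_trans (size_prime_seq_pow 1 z0)).
  rewrite expr1 ler_wpM2l// -natrX ler_nat (leq_trans _ zN)//.
  by rewrite leq_pexp2l.
have {}h : avg N (fun n => ((ndiv (prime_seq z) n)%:R - mu) ^+ 2) <= (4 * expR 4 + 9) * T ^+ 2.
  have TT1 : 1 <= T ^+ 2 by rewrite TT.
  by rewrite mulrDl; lra.
apply: (@le_trans _ _ (avg N (fun n => 1 + T ^- 2 * ((ndiv (prime_seq z) n)%:R - mu) ^+ 2 +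
  `|(omega1 n)%:R - LL N - ((ndiv (prime_seq z) n)%:R - mu)|))).
  apply: le_avg => n _; rewrite /WN -/T; set X := _ - mu; set Y := _ - X.
  have -> : (omega1 n)%:R - LL N = X + Y by rewrite /Y; ring.
  rewrite normrM normfV (ger0_norm (ltW T0)) ler_pdivrMr//.
  apply: (le_trans (ler_normD _ _)).
  have x0 := normr_ge0 X; have y0 := normr_ge0 Y.
  pose q := `|X| / T; have Xq : `|X| = q * T by rewrite divfK// gt_eqF.
  have -> : T ^- 2 * X ^+ 2 = q ^+ 2.
    by rewrite -[X ^+ 2]real_normK ?num_real// Xq; field; rewrite gt_eqF.
  have q2 : 0 <= (1 + q ^+ 2 - q) * T.
    by rewrite mulr_ge0 ?(ltW T0)//; have := sqr_ge0 (q - 1); rewrite sqrrB1; have := sqr_ge0 q; lra.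
  by rewrite Xq; have := ler_peMr y0 T1; lra.
rewrite avgD avgD avg_cst// avgZ.
have := hz N (leqnn _); rewrite -/mu => h2.
have h3 : T ^- 2 * avg N (fun n => ((ndiv (prime_seq z) n)%:R - mu) ^+ 2) <= 4 * expR 4 + 9.
  by rewrite mulrC ler_pdivrMr// exprn_gt0.
lra.
Unshelve. all: by end_near. Qed.

Lemma cvg_inv_sqrt_LL (A : R) : (fun N => A / Num.sqrt (LL N)) @ \oo --> (0 : R).
Proof.
apply/cvgrPdist_le => e e0; near=> N.
have h : (`|A| / e + 1) ^+ 2 <= LL N by near: N; exact: near_LL.
have a0 : 0 <= `|A| / e by rewrite divr_ge0// ltW.
have : `|A| / e + 1 <= Num.sqrt (LL N).
  have b0 : 0 <= `|A| / e + 1 by lra.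
  rewrite -(ger0_norm b0) -sqrtr_sqr ler_sqrt//.
  by apply: le_trans h; rewrite sqr_ge0.
move: (Num.sqrt _) => T hT; have T0 : 0 < T by lra.
rewrite sub0r normrN normrM normfV (gtr0_norm T0) ler_pdivrMr// mulrC -ler_pdivrMr//.
lra.
Unshelve. all: by end_near. Qed.

Lemma cvg_avg_cos_WN (lam nu : R) (K : nat) : (0 < K)%N ->
  (fun N => avg (N %/ K) (fun n => cos (lam * WN N n + nu))) @ \oo -->
  expR (- (lam ^+ 2 / 2)) * cos nu.
Proof.
move=> K0; apply/cvgrPdist_le => e e0.
pose E := 8 * expR (16 * lam ^+ 2) / e.
have E0 : 0 <= E by rewrite divr_ge0 ?mulr_ge0 ?expR_ge0// ltW.
pose k := (Num.truncn E).+1.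
have hk : 4 * expR (16 * lam ^+ 2) / 4 ^+ k <= e / 2.
  rewrite ler_pdivrMr ?exprn_gt0//.
  have : E < 4 ^+ k.
    apply: (lt_trans (truncnS_gt E)).
    by rewrite -natrX ltr_nat ltn_expl.
  by rewrite /E ltr_pdivrMr//; lra.
have [A hA] := @avg_cos_WN_approx lam nu K k K0 isT.
have /cvgrPdist_le/(_ (e / 2) (divr_gt0 e0 _)) := cvg_inv_sqrt_LL A.
rewrite ltr0n => /(_ isT) hT; near=> N.
rewrite distrC; apply: (@le_trans _ _ (A / Num.sqrt (LL N) + 4 * expR (16 * lam ^+ 2) / 4 ^+ k)).
  by near: N.
have : `|0 - A / Num.sqrt (LL N)| <= e / 2 by near: N.
by rewrite sub0r normrN ler_norml => /andP[_]; lra.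
Unshelve. all: by end_near. Qed.

Lemma cvg_divn_ratio (K : nat) : (0 < K)%N ->
  (fun N => (N %/ K)%:R / N%:R) @ \oo --> (K%:R^-1 : R).
Proof.
move=> K0; apply/cvgrPdist_le => e e0; near=> N.
have N0 : (0 < N)%N by near: N; exact: nbhs_infty_gt.
have eN : e^-1 <= N%:R by near: N; exact: nbhs_infty_ger.
have KR : 0 < K%:R :> R by rewrite ltr0n.
have NR : 0 < N%:R :> R by rewrite ltr0n.
apply: (@le_trans _ _ N%:R^-1); last by rewrite -[e]invrK lef_pV2// posrE invr_gt0.
have -> : K%:R^-1 - (N %/ K)%:R / N%:R = (N%:R - (N %/ K)%:R * K%:R) / K%:R / N%:R :> R.
  by field; rewrite !gt_eqF.
rewrite normrM [ `|N%:R^-1| ]ger0_norm ?invr_ge0// ler_piMl ?invr_ge0//.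
rewrite normrM [ `|K%:R^-1| ]ger0_norm ?invr_ge0// ler_pdivrMr// mul1r -natrM.
rewrite ger0_norm ?subr_ge0 ?ler_nat ?leq_trunc_div// lerBlDr -natrD ler_nat.
by rewrite {1}(divn_eq N K) addnC leq_add2r ltnW// ltn_mod.
Unshelve. all: by end_near. Qed.

Lemma cvg_sum_cos_WN (lam nu : R) (K : nat) : (0 < K)%N ->
  (fun N => (\sum_(1 <= n < (N %/ K).+1) cos (lam * WN N n + nu)) / N%:R) @ \oo -->
  K%:R^-1 * (expR (- (lam ^+ 2 / 2)) * cos nu).
Proof.
move=> K0; apply: cvg_trans (cvgM (cvg_divn_ratio K0) (@cvg_avg_cos_WN lam nu K K0)).
apply: near_eq_cvg; near=> N.
have N0 : (0 < N %/ K)%N by rewrite divn_gt0//; near: N; exact: nbhs_infty_ge.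
rewrite -[LHS]/((N %/ K)%:R / N%:R * avg (N %/ K) (fun n => cos (lam * WN N n + nu))).
by rewrite /avg mulrC -mulrA mulKf// pnatr_eq0 -lt0n.
Unshelve. all: by end_near. Qed.

End asymptotics.

(** * Restriction to [h]-free integers *)

(** Multiplication by a power of [q] can only affect whether [q] itself is counted. *)
Lemma omega1_mul_prime_pow (q h m : nat) : prime q -> (0 < m)%N ->
  (omega1 (q ^ h * m) <= (omega1 m).+1)%N /\ (omega1 m <= (omega1 (q ^ h * m)).+1)%N.
Proof.
move=> pq m0; have q0 := prime_gt0 pq.
have n0 : (0 < q ^ h * m)%N by rewrite muln_gt0 expn_gt0 q0.
have cop p : prime p -> p != q -> forall j, coprime (p ^ j) (q ^ h).
  move=> pp pq' j; apply/coprimeXl/coprimeXr.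
  by rewrite prime_coprime// dvdn_prime2.
have mem p : p != q -> (p \in [seq p <- primes (q ^ h * m) | ~~ (p ^ 2 %| q ^ h * m)%N]) =
                       (p \in [seq p <- primes m | ~~ (p ^ 2 %| m)%N]).
  move=> pq'; rewrite !mem_filter !mem_primes n0 m0/=.
  case: (boolP (prime p)) => pp; rewrite ?andbF//=.
  have c2 := cop p pp pq' 2; have := cop p pp pq' 1; rewrite expn1 => c1.
  by rewrite !Gauss_dvdr.
by split; rewrite /omega1 -[(size _).+1]/(size (q :: _)); apply: uniq_leq_size;
  rewrite ?filter_uniq ?primes_uniq// => p; rewrite inE; case: eqVneq => //= pq';
  rewrite mem.
Qed.

Section weights.
Variable R : realType.
Variable h : nat.
Implicit Types (ps : seq nat) (lam nu : R).

Definition powfree ps (n : nat) : R := \prod_(p <- ps) (1 - (p ^ h %| n)%:R).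

Lemma powfree01 ps n : 0 <= powfree ps n <= 1.
Proof.
rewrite /powfree; elim: ps => [|p ps IH]; first by rewrite big_nil ler01 lexx.
rewrite big_cons; case: (_ %| _)%N; first by rewrite subrr mul0r lexx ler01.
by rewrite subr0 mul1r.
Qed.

Lemma powfree_mul ps q m : prime q -> all prime ps -> q \notin ps ->
  powfree ps (q ^ h * m) = powfree ps m.
Proof.
move=> pq pps qps; rewrite /powfree big_seq [RHS]big_seq; apply: eq_bigr => p pin.
rewrite Gauss_dvdr//; apply/coprimeXl/coprimeXr.
have pp := allP pps _ pin; rewrite prime_coprime// dvdn_prime2//.
by apply: contraNneq qps => <-.
Qed.

Definition density ps : R := \prod_(p <- ps) (1 - (p%:R ^+ h)^-1).

(** Imposing the condition at [q] subtracts a sum over multiples of [q ^ h], which is a sum of the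
    same kind with [K * q ^ h] in place of [K]; hence the induction is over all [K]. *)
Lemma cvg_sum_powfree_cos ps (lam nu : R) (K : nat) : uniq ps -> all prime ps -> (0 < K)%N ->
  (fun N => (\sum_(1 <= n < (N %/ K).+1) powfree ps n * cos (lam * WN R N n + nu)) / N%:R)
    @ \oo --> density ps * (K%:R^-1 * (expR (- (lam ^+ 2 / 2)) * cos nu)).
Proof.
elim: ps K => [|q ps IH] K /=.
  move=> _ _ K0; rewrite /density big_nil mul1r.
  rewrite (_ : (fun N => _) = (fun N =>
    (\sum_(1 <= n < (N %/ K).+1) cos (lam * WN R N n + nu)) / N%:R)).
    exact: cvg_sum_cos_WN.
  apply/funext => N.
  by congr (_ / _); apply: eq_bigr => n _; rewrite /powfree big_nil mul1r.
case/andP=> qps ups /andP[pq pps] K0; have q0 := prime_gt0 pq.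
have qh0 : (0 < q ^ h)%N by rewrite expn_gt0 q0.
have c1 := IH K ups pps K0.
have K'0 : (0 < K * q ^ h)%N by rewrite muln_gt0 K0.
have c2 := IH (K * q ^ h)%N ups pps K'0.
(* Writing [n = q ^ h * m] leaves the weight unchanged and moves [WN] by at most [1 / sqrt (LL N)],
   so the limit is that of [c2]. *)
have c3 : (fun N => (\sum_(1 <= n < (N %/ K).+1)
    (q ^ h %| n)%:R * (powfree ps n * cos (lam * WN R N n + nu))) / N%:R)
    @ \oo --> density ps * ((K * q ^ h)%:R^-1 * (expR (- (lam ^+ 2 / 2)) * cos nu)).
  apply/cvgrPdist_le => e e0; have e20 : 0 < e / 2 by rewrite divr_gt0.
  have /cvgrPdist_le/(_ _ e20) hc2 := c2.
  have /cvgrPdist_le/(_ _ e20) hT := cvg_inv_sqrt_LL `|lam|.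
  near=> N.
  have N0 : (0 < N)%N by near: N; exact: nbhs_infty_gt.
  have NR : 0 < N%:R :> R by rewrite ltr0n.
  have hT' : `|lam| / Num.sqrt (LL R N) <= e / 2.
    have : `|0 - `|lam| / Num.sqrt (LL R N)| <= e / 2 by near: N.
    by rewrite sub0r normrN; apply: le_trans; exact: ler_norm.
  rewrite sum_multiples// -divnMA.
  apply: (le_trans (ler_distD ((\sum_(1 <= n < (N %/ (K * q ^ h)).+1)
     powfree ps n * cos (lam * WN R N n + nu)) / N%:R) _ _)).
  rewrite [leRHS](splitr e); apply: lerD; first by near: N.
  rewrite -mulrBl -sumrB normrM normfV (gtr0_norm NR) ler_pdivrMr//.
  apply: (le_trans (ler_norm_sum _ _ _)).
  apply: (@le_trans _ _ (\sum_(1 <= n < (N %/ (K * q ^ h)).+1) (e / 2))); last first.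
    rewrite sumr_const_nat subn1/= -[leLHS]mulr_natr ler_wpM2l ?(ltW e20)// ler_nat.
    exact: leq_div.
  rewrite big_nat_cond [leRHS]big_nat_cond; apply: ler_sum => m /andP[/andP[m0 _] _].
  rewrite powfree_mul// -mulrBr normrM.
  have /andP[w0 w1] := powfree01 ps m; rewrite (ger0_norm w0).
  apply: (le_trans (ler_piMl (normr_ge0 _) w1)).
  apply: (le_trans (cos_lipschitz _ _)); apply: le_trans hT'.
  have -> : lam * WN R N m + nu - (lam * WN R N (q ^ h * m)%N + nu) =
     lam / Num.sqrt (LL R N) * ((omega1 m)%:R - (omega1 (q ^ h * m))%:R).
    by rewrite /WN; ring.
  rewrite normrM [ `|_ / _| ]normrM [ `|_^-1| ]ger0_norm ?invr_ge0 ?sqrtr_ge0//.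
  rewrite ler_piMr ?divr_ge0 ?sqrtr_ge0//.
  have [a b] := omega1_mul_prime_pow h pq m0.
  rewrite -(ler_nat R) -natr1 in a; rewrite -(ler_nat R) -natr1 in b.
  by rewrite ler_norml; apply/andP; split; lra.
have -> : density (q :: ps) * (K%:R^-1 * (expR (- (lam ^+ 2 / 2)) * cos nu)) =
  density ps * (K%:R^-1 * (expR (- (lam ^+ 2 / 2)) * cos nu)) -
  density ps * ((K * q ^ h)%:R^-1 * (expR (- (lam ^+ 2 / 2)) * cos nu)).
  by rewrite /density big_cons natrM natrX invfM; ring.
apply: cvg_trans (cvgB c1 c3); apply: near_eq_cvg; near=> N.
rewrite -[LHS]/(_ / N%:R - _ / N%:R) -mulrBl -sumrB; congr (_ / _).
by apply: eq_bigr => n _; rewrite /powfree big_cons; ring.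
Unshelve. all: by end_near. Qed.

End weights.

(** * From finitely many primes to all primes *)

Section hfree.
Variable R : realType.
Variable h : nat.
Hypothesis h2 : (2 <= h)%N.

Definition hf (n : nat) : R := (hfree h n)%:R.

Lemma hfreeE n : (0 < n)%N ->
  hfree h n = all (fun p => ~~ (p ^ h %| n)%N) (prime_seq n).
Proof.
move=> n0; apply/allP/allP => H p.
  rewrite mem_prime_seq => /andP[pp pn]; apply/negP => phn.
  have pin : p \in primes n.
    by rewrite mem_primes pp n0/= (dvdn_trans _ phn)// dvdn_exp//; lia.
  have := H _ pin; move: phn; rewrite pfactor_dvdn//; lia.
rewrite mem_primes => /and3P[pp _ pn].
have /H : p \in prime_seq n by rewrite mem_prime_seq pp dvdn_leq.
rewrite pfactor_dvdn//; lia.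
Qed.

(** The two weights differ only when [n] is divisible by some [p ^ h] with [p > Y] and by none with
    [p <= Y]. *)
Lemma hf_powfree_dist Y N n : (0 < n <= N)%N ->
  `|powfree R h (prime_seq Y) n - hf n| <=
  \sum_(p <- prime_seq N | (Y < p)%N) (p ^ h %| n)%:R.
Proof.
move=> /andP[n0 nN]; rewrite /hf hfreeE//.
have S0 : 0 <= \sum_(p <- prime_seq N | (Y < p)%N) (p ^ h %| n)%:R :> R.
  by apply: sumr_ge0.
case: allP => H.
  suff -> : powfree R h (prime_seq Y) n = 1 by rewrite subrr normr0.
  rewrite /powfree big_seq big1// => p; rewrite mem_prime_seq => /andP[pp pY].
  case: (boolP (p ^ h %| n)%N) => [phn|_]; last by rewrite subr0.
  have := H p; rewrite mem_prime_seq pp phn/=.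
  rewrite (leq_trans _ (dvdn_leq n0 phn)); first by move=> /(_ isT).
  by rewrite -{1}[p]expn1 leq_exp2l ?prime_gt1//; lia.
rewrite subr0 ger0_norm; last by have /andP[] := powfree01 R h (prime_seq Y) n.
have {H} [p pin phn] : exists2 p, p \in prime_seq n & (p ^ h %| n)%N.
  apply/hasP; rewrite -[has _ _]negbK -all_predC; apply/negP => /allP H'.
  by apply: H => p /H'.
move: pin; rewrite mem_prime_seq => /andP[pp pn].
case: (leqP p Y) => pY.
  suff -> : powfree R h (prime_seq Y) n = 0 by [].
  have pin : p \in prime_seq Y by rewrite mem_prime_seq pp.
  by rewrite /powfree (big_rem p)//= phn subrr mul0r.
have /andP[_ w1] := powfree01 R h (prime_seq Y) n; apply: (le_trans w1).
have pin : p \in prime_seq N by rewrite mem_prime_seq pp (leq_trans pn).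
by rewrite (big_rem p)//= pY phn lerDl sumr_ge0.
Qed.

(** Since [h >= 2], each term is at most [1 / (p - 1) - 1 / p], which telescopes over all integers
    above [Y]. *)
Lemma sum_tail_inv_sqr Y N : (0 < Y)%N ->
  \sum_(p <- prime_seq N | (Y < p)%N) (p%:R ^- h) <= Y%:R^-1 :> R.
Proof.
move=> Y0.
have step p : (1 < p)%N -> p%:R ^- h <= p.-1%:R^-1 - p%:R^-1 :> R.
  case: p => [|[|p]]// _; rewrite -[p.+2.-1]/(p.+1) -[p.+2%:R]natr1.
  set x : R := p.+1%:R; have x1 : 1 <= x by rewrite ler1n.
  have -> : x^-1 - (x + 1)^-1 = (x * (x + 1))^-1 by field; rewrite !gt_eqF//; lra.
  rewrite lef_pV2 ?posrE ?exprn_gt0 ?mulr_gt0//; try lra.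
  apply: (@le_trans _ _ ((x + 1) ^+ 2)); first by nra.
  by rewrite ler_weXn2l//; lra.
rewrite /prime_seq big_filter_cond.
apply: (@le_trans _ _ (\sum_(1 <= p < N.+1 | (Y < p)%N) (p.-1%:R^-1 - p%:R^-1))).
  rewrite [leRHS]big_mkcond [leLHS]big_mkcond/= ler_sum// => p _.
  case: (boolP (prime p)) => /= pp; case: ltnP => // Yp; first by rewrite step ?prime_gt1.
  by apply: le_trans (step p _); [rewrite invr_ge0 exprn_ge0|lia].
suff : \sum_(1 <= p < N.+1 | (Y < p)%N) (p.-1%:R^-1 - p%:R^-1) <=
   (if (Y <= N)%N then Y%:R^-1 - N%:R^-1 else 0) :> R.
  move/le_trans; apply; case: ifP => _; first by rewrite gerBl invr_ge0.
  by rewrite invr_ge0.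
elim: N => [|N IH]; first by rewrite big_geq// leqNgt Y0.
rewrite big_mkcond big_nat_recr//= -big_mkcond/=.
apply: (le_trans (lerD IH (lexx _))).
case: (ltngtP Y N.+1) => [YN|YN|->].
- by rewrite ltnS in YN; rewrite YN addrA subrK.
- by rewrite leqNgt (ltn_trans _ YN)// addr0.
by rewrite ltnn addr0 subrr.
Qed.

Lemma sum_hf_dist Y N (F : nat -> R) : (0 < Y)%N -> (forall n, `|F n| <= 1) ->
  `|(\sum_(1 <= n < N.+1) powfree R h (prime_seq Y) n * F n) / N%:R -
    (\sum_(1 <= n < N.+1) hf n * F n) / N%:R| <= Y%:R^-1.
Proof.
move=> Y0 F1; have [->|N0] := posnP N; first by rewrite !big_geq// subrr normr0.
have NR : 0 < N%:R :> R by rewrite ltr0n.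
apply: le_trans (sum_tail_inv_sqr N Y0).
rewrite -mulrBl -sumrB normrM normfV (gtr0_norm NR) ler_pdivrMr//.
apply: (le_trans (ler_norm_sum _ _ _)).
apply: (@le_trans _ _ (\sum_(1 <= n < N.+1) \sum_(p <- prime_seq N | (Y < p)%N) (p ^ h %| n)%:R)).
  rewrite big_nat_cond [leRHS]big_nat_cond; apply: ler_sum => n /andP[nN _].
  rewrite -mulrBl normrM; apply: le_trans (hf_powfree_dist Y nN).
  by rewrite ler_piMr.
rewrite exchange_big/= mulr_suml big_seq_cond [leRHS]big_seq_cond; apply: ler_sum => p.
rewrite mem_prime_seq => /andP[/andP[pp _] _]; have p0 := prime_gt0 pp.
under eq_bigr do rewrite -[(_ %| _)%:R]mulr1.
rewrite (sum_multiples (fun=> 1)) ?expn_gt0 ?p0// sumr_const_nat subn1/=.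
rewrite mulrC ler_pdivlMr ?exprn_gt0 ?ltr0n// -natrX -natrM ler_nat.
exact: leq_trunc_div.
Qed.

(** Comparison with the product of [1 - 1 / k ^ 2] over all [2 <= k <= Y], which equals
    [(1 + 1 / Y) / 2]. The bound has to be uniform in [Y]. *)
Lemma density_ge Y : 2^-1 <= density R h (prime_seq Y).
Proof.
case: (posnP Y) => [->|Y0]; first by rewrite /density big_nil; lra.
apply: (@le_trans _ _ (2^-1 * (1 + Y%:R^-1))).
  by rewrite ler_pMr// lerDl invr_ge0.
elim: Y Y0 => // Y IH _.
have [->|Y0] := posnP Y; first by rewrite /density big_nil invr1; lra.
have {}IH := IH Y0.
rewrite /density /prime_seq big_filter big_mkcond big_nat_recr//= -big_mkcond.
rewrite -big_filter -/(prime_seq Y) -/(density R h (prime_seq Y)).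
rewrite -[Y.+1%:R]natr1; set x : R := Y%:R in IH *.
have x1 : 1 <= x by rewrite ler1n.
have f : 1 - ((x + 1) ^+ 2)^-1 <= if prime Y.+1 then 1 - ((x + 1) ^+ h)^-1 else 1.
  case: ifP => _; last by rewrite gerBl invr_ge0 sqr_ge0.
  rewrite lerD2l lerN2 lef_pV2 ?posrE ?exprn_gt0//; try lra.
  by rewrite ler_weXn2l//; lra.
have f0 : 0 <= 1 - ((x + 1) ^+ 2)^-1.
  rewrite subr_ge0 invf_le1 ?exprn_gt0//; last by lra.
  by rewrite exprn_ege1//; lra.
apply: le_trans (ler_pM _ f0 IH f); last first.
  by rewrite mulr_ge0 ?invr_ge0// addr_ge0// invr_ge0; lra.
rewrite le_eqVlt; apply/orP; left; apply/eqP; field.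
by rewrite !gt_eqF//; lra.
Qed.

Let SH (N : nat) : R := \sum_(1 <= n < N.+1) hf n.

(** The density constant [c] occurs both in the cosine sum and in the count, so comparing the two
    avoids computing the density of the [h]-free integers. *)
Lemma hfree_weighted_cos (lam nu : R) : forall e : R, 0 < e -> \forall N \near \oo,
  4^-1 <= SH N / N%:R /\
  `|(\sum_(1 <= n < N.+1) hf n * cos (lam * WN R N n + nu)) / N%:R -
    SH N / N%:R * (expR (- (lam ^+ 2 / 2)) * cos nu)| <= e.
Proof.
(* [1 / Y <= e / 8] serves the precision; [1 / Y <= 1 / 8] keeps the proportion of [h]-free integers
   above [1 / 2 - 1 / 8 - 1 / 8]. *)
move=> e e0; pose Y := ((Num.truncn (8 / e)).+1 + 8)%N.
have Y8 : 8%:R <= Y%:R :> R by rewrite ler_nat leq_addl.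
have YR : 0 < Y%:R :> R by rewrite ltr0n.
have Ye : Y%:R^-1 <= e / 8.
  rewrite -[_ / _]invrK lef_pV2 ?posrE ?invr_gt0 ?divr_gt0// invf_div.
  by apply: ltW; apply: (lt_le_trans (truncnS_gt _)); rewrite ler_nat leq_addr.
have Y8' : Y%:R^-1 <= 8^-1 :> R by rewrite lef_pV2 ?posrE.
set c := density R h (prime_seq Y); have c2 : 2^-1 <= c := density_ge Y.
set g := expR _ * cos nu.
have g1 : `|g| <= 1.
  rewrite normrM ger0_norm ?expR_ge0// mulr_ile1 ?expR_ge0 ?cos_max//.
  by rewrite expR_le1 oppr_le0 divr_ge0// sqr_ge0.
have hG := @cvg_sum_powfree_cos R h (prime_seq Y) lam nu 1 (prime_seq_uniq Y) (prime_seq_prime Y) isT.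
(* With [lam = nu = 0] the cosine is [1], and the statement counts the sieved integers. *)
have hH := @cvg_sum_powfree_cos R h (prime_seq Y) 0 0 1 (prime_seq_uniq Y) (prime_seq_prime Y) isT.
have e80 : 0 < Num.min (e / 8) 8^-1 by rewrite lt_min divr_gt0//= invr_gt0.
move/cvgrPdist_le/(_ _ e80): hG; move/cvgrPdist_le/(_ _ e80): hH.
rewrite invr1 !mul1r expr0n/= mul0r oppr0 expR0 cos0 !mulr1 -/c -/g.
move=> hH hG; near=> N.
have N0 : (0 < N)%N by near: N; exact: nbhs_infty_gt.
have nG : `|c * g - (\sum_(1 <= n < (N %/ 1).+1) powfree R h (prime_seq Y) n *
    cos (lam * WN R N n + nu)) / N%:R| <= Num.min (e / 8) 8^-1 by near: N.
have nH : `|c - (\sum_(1 <= n < (N %/ 1).+1) powfree R h (prime_seq Y) n *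
    cos (0 * WN R N n + 0)) / N%:R| <= Num.min (e / 8) 8^-1 by near: N.
move: nG nH; rewrite divn1 !le_min.
under [in X in _ -> X -> _]eq_bigr do rewrite mul0r addr0 cos0.
have Y0 : (0 < Y)%N by rewrite addn_gt0.
have dG := @sum_hf_dist Y N (fun n => cos (lam * WN R N n + nu)) Y0 (fun n => cos_max _).
have dH := @sum_hf_dist Y N (fun=> 1) Y0 (fun n => ltac:(by rewrite normr1)).
have eS : \sum_(1 <= n < N.+1) hf n * 1 = SH N by apply: eq_bigr => n _; rewrite mulr1.
rewrite eS in dH; move: dG dH.
move=> dG dH /andP[nG1 nG2] /andP[nH1 nH2]; move: dG dH nG1 nH1 nH2.
set a := (\sum_(_ <= _ < _) powfree _ _ _ _ * cos _) / _.
set b := (\sum_(_ <= _ < _) hf _ * cos _) / _.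
set H' := (\sum_(_ <= _ < _) powfree _ _ _ _ * 1) / _.
set H := SH N / _ => dG dH nG1 nH1 nH2; split.
  by move: nH2 dH; rewrite !ler_norml => /andP[? ?] /andP[? ?]; lra.
have cH : `|c - H| <= e / 4 by apply: (le_trans (ler_distD H' _ _)); lra.
have -> : b - H * g = - (a - b) - (c * g - a) + (c - H) * g by ring.
apply: (le_trans (ler_normD _ _)).
have : `|(c - H) * g| <= e / 4.
  by rewrite normrM; apply: le_trans cH; rewrite ler_piMr.
have := ler_normB (- (a - b)) (c * g - a); rewrite normrN.
by lra.
Unshelve. all: by end_near. Qed.

Lemma hfree_density_ge : \forall N \near \oo, 4^-1 <= SH N / N%:R.
Proof.
have := @hfree_weighted_cos 0 0 1 ltr01; apply: filterS => N; by case.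
Qed.

Definition havg N (F : nat -> R) : R := (\sum_(1 <= n < N.+1) hf n * F n) / SH N.

Lemma hf_ge0 n : 0 <= hf n. Proof. exact: ler0n. Qed.

Lemma hf_sum_gt0 N : (0 < N)%N -> 0 < SH N.
Proof.
move=> N0; rewrite /SH big_ltn// ltr_pwDl//; apply: sumr_ge0 => n _; exact: hf_ge0.
Qed.

Lemma cvg_havg_cos (lam nu : R) :
  (fun N => havg N (fun n => cos (lam * WN R N n + nu))) @ \oo -->
  expR (- (lam ^+ 2 / 2)) * cos nu.
Proof.
apply/cvgrPdist_le => e e0.
have e4 : 0 < e / 4 by rewrite divr_gt0.
have := @hfree_weighted_cos lam nu _ e4; apply: filterS2 (nbhs_infty_gt 0) => N N0.
move=> [H4 hd]; have S0 := hf_sum_gt0 N0; have NR : 0 < N%:R :> R by rewrite ltr0n.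
have H0 : 0 < SH N / N%:R by rewrite divr_gt0.
rewrite distrC; move: hd; set g := _ * cos nu.
have -> : havg N (fun n => cos (lam * WN R N n + nu)) - g =
  ((\sum_(1 <= n < N.+1) hf n * cos (lam * WN R N n + nu)) / N%:R - SH N / N%:R * g) / (SH N / N%:R).
  by rewrite /havg; field; rewrite !gt_eqF.
move=> hd; rewrite normrM normfV (gtr0_norm H0) ler_pdivrMr//.
by apply: (le_trans hd); rewrite ler_wpM2l// ltW.
Qed.

Lemma havg_abs_WN_bounded : exists A : R, \forall N \near \oo,
  havg N (fun n => `|WN R N n|) <= A.
Proof.
have [A hA] := avg_abs_WN_bounded R; exists (4 * A).
near=> N.
have N0 : (0 < N)%N by near: N; exact: nbhs_infty_gt.
have S0 := hf_sum_gt0 N0; have NR : 0 < N%:R :> R by rewrite ltr0n.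
have hW : avg N (fun n => `|WN R N n|) <= A by near: N.
have h4 : 4^-1 <= SH N / N%:R by near: N; exact: hfree_density_ge.
have h0 : 0 <= avg N (fun n => `|WN R N n|) by apply: avg_ge0.
rewrite ler_pdivlMr// in h4.
rewrite /havg ler_pdivrMr//; apply: (@le_trans _ _ (N%:R * A)); last first.
  by have := ler_wpM2l (le_trans h0 hW) h4; lra.
apply: le_trans (ler_wpM2l (ltW NR) hW).
rewrite /avg mulrC divfK ?gt_eqF//; apply: ler_sum => n _.
by rewrite ler_piMl// /hf; case: hfree.
Unshelve. all: by end_near. Qed.

End hfree.

(** * The Gaussian law *)

Section gaussian.
Variable R : realType.
Implicit Types (f g : R -> R) (u x lam nu : R).

Let mu := @lebesgue_measure R.
Let phi : R -> R := normal_pdf 0 1.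

(* The identity, as the random variable whose [cdf] is [Phi]. *)
Let idTR : measurableTypeR R -> R := idfun.

#[local] HB.instance Definition _ :=
  @isMeasurableFun.Build _ _ _ _ idTR (@measurable_id _ _ setT).

Lemma gauss_pdfE u : phi u = (Num.sqrt (2 * pi))^-1 * expR (- u ^+ 2 / 2).
Proof.
rewrite /phi normal_pdfE ?oner_neq0// /normal_peak /normal_fun subr0 expr1n mul1r.
by rewrite mulr_natl.
Qed.

Lemma gauss_pdf_ge0 u : 0 <= phi u.
Proof. exact: normal_pdf_ge0. Qed.

Lemma gauss_peak_le1 : (Num.sqrt (2 * pi))^-1 <= 1 :> R.
Proof.
have p2 := pi_ge2 R.
rewrite invf_le1 ?sqrtr_gt0 ?mulr_gt0 ?pi_gt0// -[1 in leLHS]sqrtr1 ler_sqrt//; lra.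
Qed.

Lemma gauss_pdf_le u : phi u <= expR (- u ^+ 2 / 2).
Proof. by rewrite gauss_pdfE ler_piMl ?expR_ge0// gauss_peak_le1. Qed.

Lemma gauss_pdf_le1 u : phi u <= 1.
Proof.
apply: (le_trans (gauss_pdf_le u)).
by rewrite expR_le1 mulNr oppr_le0 divr_ge0// sqr_ge0.
Qed.

Lemma is_derive_gauss_pdf u : is_derive u 1 phi (- u * phi u).
Proof.
have -> : phi = (Num.sqrt (2 * pi))^-1 \*: (expR \o (- (2^-1 \*: (id ^+ 2)))).
  apply/funext => x; rewrite gauss_pdfE /= !fctE /GRing.scale/=.
  by congr (_ * expR _); rewrite mulNr mulrC.
apply: is_derive_eq; rewrite /= !fctE /GRing.scale/= expr1 mulr1.
by move: (expR _) (_^-1) => a b; field.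
Qed.

Lemma continuous_gauss_pdf : continuous phi.
Proof. by apply: continuous_normal_pdf; rewrite oner_neq0. Qed.

Lemma integrable_mul_gauss f (C : R) : measurable_fun setT f -> (forall u, `|f u| <= C) ->
  mu.-integrable setT (EFin \o (fun u => f u * phi u)).
Proof.
move=> mf fC.
have := @integrableMr _ _ _ mu setT measurableT f _ mf _ (integrable_normal_pdf 0 1).
move=> h.
have -> : EFin \o (fun u => f u * phi u) = ((EFin \o f) \* (fun x => (normal_pdf 0 1 x)%:E))%E.
  by apply/funext => u /=; rewrite EFinM.
apply: h; exists C; split; first exact: num_real.
by move=> x Cx u _ /=; apply: le_trans (fC u) (ltW Cx).
Qed.

Definition gauss_exp f : R := \int[mu]_(u in setT) (f u * phi u).

Definition bounded_measurable f :=
  measurable_fun setT f /\ exists C : R, forall u, `|f u| <= C.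

Lemma bounded_measurable_integrable f : bounded_measurable f ->
  mu.-integrable setT (EFin \o (fun u => f u * phi u)).
Proof. by move=> [mf [C fC]]; exact: integrable_mul_gauss fC. Qed.

Lemma bounded_measurableD f g : bounded_measurable f -> bounded_measurable g ->
  bounded_measurable (fun u => f u + g u).
Proof.
move=> [mf [C fC]] [mg [D gD]]; split; first exact: measurable_funD.
by exists (C + D) => u; apply: (le_trans (ler_normD _ _)); apply: lerD.
Qed.

Lemma bounded_measurableZ c f : bounded_measurable f -> bounded_measurable (fun u => c * f u).
Proof.
move=> [mf [C fC]]; split; first exact: measurable_funM.
by exists (`|c| * C) => u; rewrite normrM ler_wpM2l.
Qed.

Lemma bounded_measurable_continuous f (C : R) : continuous f -> (forall u, `|f u| <= C) ->
  bounded_measurable f.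
Proof.
by move=> cf fC; split; [exact: continuous_measurable_fun | exists C].
Qed.

Lemma bounded_measurable_indic (A : set R) : measurable A ->
  bounded_measurable (\1_A : R -> R).
Proof.
move=> mA; split; first exact: measurable_indic.
by exists 1 => u; rewrite indicE; case: (_ \in _); rewrite ?normr1 ?normr0.
Qed.

Lemma gauss_expD f g : bounded_measurable f -> bounded_measurable g ->
  gauss_exp (fun u => f u + g u) = gauss_exp f + gauss_exp g.
Proof.
move=> bf bg; rewrite /gauss_exp -RintegralD//; last 2 first.
- exact: bounded_measurable_integrable.
- exact: bounded_measurable_integrable.
by apply: eq_Rintegral => u _; rewrite mulrDl.
Qed.

Lemma gauss_expZ c f : bounded_measurable f ->
  gauss_exp (fun u => c * f u) = c * gauss_exp f.
Proof.
move=> bf; rewrite /gauss_exp -RintegralZl//; last exact: bounded_measurable_integrable.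
by apply: eq_Rintegral => u _; rewrite mulrA.
Qed.

Lemma le_gauss_exp f g : bounded_measurable f -> bounded_measurable g ->
  (forall u, f u <= g u) -> gauss_exp f <= gauss_exp g.
Proof.
move=> bf bg fg; apply: le_Rintegral => //; try exact: bounded_measurable_integrable.
by move=> u _; rewrite ler_wpM2r// gauss_pdf_ge0.
Qed.

Lemma gauss_exp_indic (A : set R) : measurable A ->
  gauss_exp \1_A = fine (normal_prob 0 1 A).
Proof.
move=> mA; rewrite /gauss_exp /normal_prob /Rintegral.
rewrite [in RHS]integral_mkcond; congr fine; apply: eq_integral => u _.
rewrite patchE indicE; case: ifPn => uA.
  by rewrite mul1r.
by rewrite mul0r.
Qed.

Lemma gauss_exp_cst c : gauss_exp (fun=> c) = c.
Proof.
have -> : (fun=> c) = (fun u => c * \1_setT u) :> (R -> R).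
  by apply/funext => u; rewrite indicE in_setT mulr1.
rewrite gauss_expZ; last exact: bounded_measurable_indic.
by rewrite gauss_exp_indic// probability_setT mulr1.
Qed.

Lemma integrable_gauss (D : set R) : measurable D ->
  mu.-integrable D (EFin \o (fun u => expR (- u ^+ 2 / 2))).
Proof.
move=> mD; apply: (@integrableS _ _ _ mu setT) => //.
have c0 : Num.sqrt (2 * pi) != 0 :> R by rewrite gt_eqF// sqrtr_gt0 mulr_gt0// pi_gt0.
have := @integrableZl _ _ _ mu setT measurableT (Num.sqrt (2 * pi)) _ (integrable_normal_pdf 0 1).
apply: eq_integrable => // u _ /=; rewrite -EFinM.
by rewrite -/(phi u) gauss_pdfE mulVKf.
Qed.

Lemma PhiE (a : R) : Phi a = gauss_exp \1_`]-oo, a].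
Proof.
rewrite gauss_exp_indic// /Phi -RintegralZl//; last exact: integrable_gauss.
rewrite /normal_prob /Rintegral; congr fine; apply: eq_integral => u _.
by rewrite -/(phi u) gauss_pdfE.
Qed.

(** Gives access to the limits of a distribution function at both infinities. *)
Lemma Phi_cdf (a : R) : (Phi a)%:E = cdf (idTR : {RV (normal_prob 0 1) >-> R}) a.
Proof.
rewrite PhiE gauss_exp_indic// fineK; last exact: fin_num_measure.
by rewrite /cdf /distribution /pushforward preimage_id.
Qed.

Lemma cvg_Phi_y : (@Phi R a) @[a --> +oo] --> (1 : R).
Proof.
have := @cvg_cdfy1 _ _ _ _ (idTR : {RV (normal_prob 0 1) >-> R}).
move/fine_cvg; apply: cvg_trans; apply: near_eq_cvg; apply: nearW => a.
exact: (congr1 fine (esym (Phi_cdf a))).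
Qed.

Lemma cvg_Phi_Ny : (@Phi R a) @[a --> -oo] --> (0 : R).
Proof.
have := @cvg_cdfNy0 _ _ _ _ (idTR : {RV (normal_prob 0 1) >-> R}).
move/fine_cvg; apply: cvg_trans; apply: near_eq_cvg; apply: nearW => a.
exact: (congr1 fine (esym (Phi_cdf a))).
Qed.

Lemma Phi_lipschitz (a e : R) : 0 <= e -> Phi (a + e) <= Phi a + e.
Proof.
move=> e0; rewrite -lerBlDl !PhiE.
have ba (b : R) := bounded_measurable_indic (measurable_itv `]-oo, b]).
have bb := bounded_measurable_indic (measurable_itv `]a, a + e]).
rewrite lerBlDl.
have -> : \1_`]-oo, a + e] = (fun u => \1_`]-oo, a] u + \1_`]a, a + e] u) :> (R -> R).
  apply/funext => u; rewrite !indicE !mem_setE !in_itv/=.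
  have [ua|ua] := leP u a; last by rewrite add0r.
  by rewrite addr0 (le_trans ua)// lerDl.
rewrite gauss_expD// lerD2l.
apply: (@le_trans _ _ (\int[mu]_(u in setT) \1_`]a, a + e] u)).
  apply: le_Rintegral => //.
  - exact: bounded_measurable_integrable.
  - exact: integrable_indic_itv.
  - by move=> u _; rewrite ler_piMr// gauss_pdf_le1.
rewrite /Rintegral integral_indic//= setIT /mu lebesgue_measure_itv/=.
rewrite lte_fin; case: ifPn => _ //=.
by rewrite addrC addKr.
Qed.

Lemma continuous_trig lam nu : continuous (fun u => cos (lam * u + nu)).
Proof.
move=> u; apply: (@continuous_comp _ _ _ (fun u => lam * u + nu) cos); last exact: continuous_cos.
apply: cvgD; last exact: cvg_cst.
by apply: cvgM; [exact: cvg_cst|exact: cvg_id].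
Qed.

Lemma bounded_measurable_cos lam nu : bounded_measurable (fun u => cos (lam * u + nu)).
Proof.
apply: (@bounded_measurable_continuous _ 1); first exact: continuous_trig.
by move=> u; exact: cos_max.
Qed.

(** * The Gaussian average of a cosine *)

Section truncated.
Variables (A nu : R).
Hypothesis A0 : 0 < A.
(** On a bounded segment all integrands are continuous on a compact set, and the derivative in [lam]
    is dominated by the constant [A]. *)
Let G lam := \int[mu]_(u in `[- A, A]) (cos (lam * u + nu) * phi u).
Let G' lam := \int[mu]_(u in `[- A, A]) (- u * sin (lam * u + nu) * phi u).

Lemma is_derive_cos_lin lam u : is_derive lam 1 (fun lam => cos (lam * u + nu)) (- u * sin (lam * u + nu)).
Proof.
have -> : (fun lam => cos (lam * u + nu)) = cos \o (u \*: id + cst nu).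
  by apply/funext => l /=; rewrite fctE /= mulrC.
apply: is_derive_eq; rewrite !fctE /GRing.scale/= addr0 mulr1 mulrC.
by rewrite mulrN mulNr; congr (- (_ * sin (_ + _))); exact: mulrC.
Qed.

Lemma is_derive_sin_lin lam u : is_derive u 1 (fun u => sin (lam * u + nu)) (lam * cos (lam * u + nu)).
Proof.
have -> : (fun u => sin (lam * u + nu)) = sin \o (lam \*: id + cst nu).
  by apply/funext => l.
by apply: is_derive_eq; rewrite !fctE /GRing.scale/= addr0 mulr1 mulrC.
Qed.

Lemma continuous_sin_lin lam : continuous (fun u => sin (lam * u + nu)).
Proof.
move=> u; apply: differentiable_continuous; apply/derivable1_diffP.
by have [] := is_derive_sin_lin lam u.
Qed.

Lemma integrable_segment f : continuous f -> mu.-integrable `[- A, A] (EFin \o f).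
Proof.
move=> cf; apply: continuous_compact_integrable; first exact: segment_compact.
exact: continuous_subspaceT.
Qed.

Lemma is_derive_G lam : is_derive lam 1 G (G' lam).
Proof.
have d1 (l u : R) : is_derive l 1 (fun l => cos (l * u + nu) * phi u) (- u * sin (l * u + nu) * phi u).
  have -> : (fun l => cos (l * u + nu) * phi u) = phi u \*: (fun l => cos (l * u + nu)).
    by apply/funext => x /=; rewrite /GRing.scale/= mulrC.
  apply: (is_derive_eq (is_deriveZ (phi u) (is_derive_cos_lin l u))).
  by rewrite /GRing.scale/= mulrC.
have p1 (l u : R) : partial1of2 (fun l u => cos (l * u + nu) * phi u) l u = - u * sin (l * u + nu) * phi u.
  by rewrite partial1of2E; have [_ ->] := d1 l u.
have Il : `]lam - 1, lam + 1[%classic lam by rewrite /= in_itv/=; apply/andP; split; lra.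
have int_f x : `]lam - 1, lam + 1[%classic x ->
    mu.-integrable `[- A, A] (EFin \o (fun u => cos (x * u + nu) * phi u)).
  move=> _; apply: integrable_segment => u; apply: cvgM; first exact: continuous_trig.
  exact: continuous_gauss_pdf.
have der x (u : R) : `]lam - 1, lam + 1[%classic x -> `[- A, A]%classic u ->
    derivable ((fun l u => cos (l * u + nu) * phi u) ^~ u) x 1.
  by move=> _ _; have [] := d1 x u.
have int_A : mu.-integrable `[- A, A] (EFin \o (fun=> A)).
  by apply: integrable_segment => u; exact: cvg_cst.
have ub x (u : R) : `]lam - 1, lam + 1[%classic x -> `[- A, A]%classic u ->
    `|partial1of2 (fun l u => cos (l * u + nu) * phi u) x u| <= A.
  move=> _ /=; rewrite in_itv/= => uA; rewrite p1 !normrM normrN (ger0_norm (gauss_pdf_ge0 u)).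
  rewrite -ler_norml in uA; rewrite -[leRHS]mulr1 ler_pM ?gauss_pdf_le1 ?gauss_pdf_ge0 ?mulr_ge0//.
  by rewrite -[leRHS]mulr1 ler_pM// sin_max.
apply: DeriveDef.
  exact: (@derivable_under_integral R _ _ mu _ _ (measurable_itv _) lam _ _ Il int_f der
    (fun=> A) (fun=> ltW A0) int_A ub).
rewrite -derive1E (@differentiation_under_integral R _ _ mu _ _ (measurable_itv _) lam _ _ Il int_f der
  (fun=> A) (fun=> ltW A0) int_A ub).
by apply: eq_Rintegral => u _; rewrite p1.
Qed.

(* [G'] is the derivative of [G], so [G] solves [G' = - lam * G] up to a boundary
   term that vanishes as [A] grows. *)
Lemma G_by_parts lam : lam * G lam + G' lam =
  sin (lam * A + nu) * phi A - sin (lam * - A + nu) * phi (- A).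
Proof.
have NAA : - A < A by rewrite gtrN.
pose F u := sin (lam * u + nu) * phi u.
pose f u := lam * (cos (lam * u + nu) * phi u) + (- u * sin (lam * u + nu) * phi u).
have cc : continuous (fun u => cos (lam * u + nu) * phi u).
  by move=> u; apply: cvgM; [exact: continuous_trig|exact: continuous_gauss_pdf].
have cs : continuous (fun u => - u * sin (lam * u + nu) * phi u).
  move=> u; apply: cvgM; last exact: continuous_gauss_pdf.
  by apply: cvgM; [apply: cvgN; exact: cvg_id|exact: continuous_sin_lin].
have cf : continuous f.
  by move=> u; apply: cvgD; [apply: cvgM; [exact: cvg_cst|exact: cc]|exact: cs].
have cF : continuous F.
  by move=> u; apply: cvgM; [exact: continuous_sin_lin|exact: continuous_gauss_pdf].
have dF (u : R) : is_derive u 1 F (f u).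
  have -> : F = (fun u => sin (lam * u + nu)) * phi by [].
  have h1 := is_derive_sin_lin lam u; have h2 := is_derive_gauss_pdf u.
  apply: is_derive_eq.
  by rewrite /f /GRing.scale/=; ring.
have dF' : derivable_oo_LRcontinuous F (- A) A.
  split; first by move=> u _; have [] := dF u.
    by apply: cvg_at_right_filter; exact: cF.
  by apply: cvg_at_left_filter; exact: cF.
have F'f : {in `]- A, A[, derive1 F =1 f}.
  by move=> u _; rewrite derive1E; have [_ ->] := dF u.
have := continuous_FTC2 NAA (continuous_subspaceT cf) dF' F'f.
move=> /(congr1 fine) /= <-.
rewrite -/(Rintegral _ _ _) /G -RintegralZl//; last exact: integrable_segment.
rewrite -RintegralD//; last exact: integrable_segment.
by apply: (integrable_segment (f := fun u => lam * (cos (lam * u + nu) * phi u))) => u;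
  apply: cvgM; [exact: cvg_cst|exact: cc].
Qed.

(** The integrating factor [expR (l ^ 2 / 2)] leaves only the boundary term in the derivative of
    [K]. The mean value theorem gives a point [c] with [|c| <= |lam|], so that the factor at [c] is
    absorbed by [expR (- lam ^ 2 / 2)]. *)
Lemma G_bound lam : `|G lam - expR (- (lam ^+ 2 / 2)) * G 0| <= 2 * `|lam| * expR (- A ^+ 2 / 2).
Proof.
pose K l := G l * expR (l ^+ 2 / 2).
have dK (l : R) : is_derive l 1 K
    ((sin (l * A + nu) * phi A - sin (l * - A + nu) * phi (- A)) * expR (l ^+ 2 / 2)).
  have -> : K = G * (expR \o (2^-1 \*: (id ^+ 2))).
    by apply/funext => x; rewrite /K -[RHS]/(G x * expR (2^-1 * x ^+ 2)) [2^-1 * _]mulrC.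
  have hG := is_derive_G l; apply: is_derive_eq.
  rewrite -G_by_parts !fctE /GRing.scale/= expr1 mulr1 [2^-1 * _]mulrC.
  rewrite (_ : 2^-1 *: l ^+ 2 = l ^+ 2 / 2); last exact: mulrC.
  by move: (expR _) (G _) (G' _) => a b c; field.
have bd (l : R) : `|sin (l * A + nu) * phi A - sin (l * - A + nu) * phi (- A)| <=
    2 * expR (- A ^+ 2 / 2).
  have b1 := gauss_pdf_le A; have b2 := gauss_pdf_le (- A); rewrite sqrrN in b2.
  have p1 := gauss_pdf_ge0 A; have p2 := gauss_pdf_ge0 (- A).
  have s1 := sin_max (l * A + nu); have s2 := sin_max (l * - A + nu).
  apply: (le_trans (ler_normB _ _)); rewrite !normrM (ger0_norm p1) (ger0_norm p2).
  have := ler_piMl p1 s1; have := ler_piMl p2 s2; lra.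
have cK : continuous K.
  move=> l; apply: differentiable_continuous; apply/derivable1_diffP.
  by have [] := dK l.
have [c [clam Kc]] : exists c, `|c| <= `|lam| /\ `|K lam - K 0| <=
    2 * expR (- A ^+ 2 / 2) * expR (c ^+ 2 / 2) * `|lam|.
  have fin c (x : R) : `|((sin (c * A + nu) * phi A - sin (c * - A + nu) * phi (- A)) *
      expR (c ^+ 2 / 2)) * x| <= 2 * expR (- A ^+ 2 / 2) * expR (c ^+ 2 / 2) * `|x|.
    rewrite normrM [ `|_ * expR _| ]normrM (ger0_norm (expR_ge0 _)) ler_wpM2r// ler_wpM2r ?expR_ge0//.
  have [l0|l0] := leP 0 lam.
    have [c] := MVT_segment l0 (fun x _ => dK x) (continuous_subspaceT cK).
    rewrite in_itv/= => /andP[c0 cl] ->; exists c.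
    by rewrite (ger0_norm l0) (ger0_norm c0) subr0; split => //; rewrite -{2}(ger0_norm l0).
  have [c] := MVT_segment (ltW l0) (fun x _ => dK x) (continuous_subspaceT cK).
  rewrite in_itv/= => /andP[c0 cl] e; exists c; rewrite distrC e; split.
    by rewrite (ltr0_norm l0) (ler0_norm cl) lerN2.
  by rewrite sub0r; apply: (le_trans (fin _ _)); rewrite normrN.
have -> : G lam - expR (- (lam ^+ 2 / 2)) * G 0 = expR (- (lam ^+ 2 / 2)) * (K lam - K 0).
  rewrite /K expr0n/= mul0r expR0 mulr1 mulrBr; congr (_ - _).
  by rewrite mulrCA -expRD addNr expR0 mulr1.
rewrite normrM (ger0_norm (expR_ge0 _)).
apply: (le_trans (ler_wpM2l (expR_ge0 _) Kc)).
have e1 : expR (- (lam ^+ 2 / 2)) * expR (c ^+ 2 / 2) <= 1.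
  rewrite -expRD expR_le1 addrC subr_le0 ler_pM2r ?invr_gt0//.
  by rewrite -real_normK ?num_real// -[leRHS]real_normK ?num_real// lerXn2r ?nnegrE.
have e2 : 0 <= 2 * `|lam| * expR (- A ^+ 2 / 2) by rewrite !mulr_ge0// expR_ge0.
rewrite [leLHS](_ : _ = expR (- (lam ^+ 2 / 2)) * expR (c ^+ 2 / 2) * (2 * `|lam| * expR (- A ^+ 2 / 2))).
  by rewrite ler_piMl.
by ring.
Qed.

Lemma G0E : G 0 = cos nu * gauss_exp \1_`[- A, A].
Proof.
rewrite gauss_exp_indic// /normal_prob -/(Rintegral _ _ _) -RintegralZl//.
  by apply: eq_Rintegral => u _; rewrite mul0r add0r.
by apply: integrable_segment; exact: continuous_gauss_pdf.
Qed.

(** The mass outside the segment is paid twice: once for cutting the integral, and once because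
    [G 0] contains the mass of the segment instead of [1]. *)
Lemma gauss_exp_cos_truncated lam :
  `|gauss_exp (fun u => cos (lam * u + nu)) - expR (- (lam ^+ 2 / 2)) * cos nu| <=
  2 * `|lam| * expR (- A ^+ 2 / 2) + 2 * (1 - gauss_exp \1_`[- A, A]).
Proof.
pose I : R -> R := \1_`[- A, A].
have bI : bounded_measurable I by exact: bounded_measurable_indic.
have bc := bounded_measurable_cos lam nu.
have bcI : bounded_measurable (fun u => I u * cos (lam * u + nu)).
  split; first by apply: measurable_funM; [exact: bI.1|exact: bc.1].
  exists 1 => u; rewrite normrM mulr_ile1 ?cos_max// /I indicE.
  by case: (_ \in _); rewrite ?normr1 ?normr0.
have eG : G lam = gauss_exp (fun u => I u * cos (lam * u + nu)).
  rewrite /G /gauss_exp Rintegral_mkcond; apply: eq_Rintegral => u _.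
  by rewrite patchE /I indicE; case: ifPn => uA; rewrite ?mul1r ?mul0r.
have h := G_bound lam; rewrite G0E eG in h.
have b1 : bounded_measurable (fun u => 1 + (- 1) * I u).
  apply: bounded_measurableD; last exact: bounded_measurableZ.
  by apply: (@bounded_measurable_continuous _ 1) => [u|u]; [exact: cvg_cst|rewrite normr1].
have e1 : gauss_exp (fun u => 1 + (- 1) * I u) = 1 - gauss_exp I.
  rewrite (gauss_expD (f := fun=> 1)) ?gauss_expZ ?gauss_exp_cst ?mulN1r//.
    by apply: (@bounded_measurable_continuous _ 1) => [u|u]; [exact: cvg_cst|rewrite normr1].
  exact: bounded_measurableZ.
have I01 u : 0 <= I u <= 1 by rewrite /I indicE; case: (_ \in _); rewrite ?lexx ?ler01.
have up : gauss_exp (fun u => cos (lam * u + nu)) <=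
    gauss_exp (fun u => I u * cos (lam * u + nu)) + (1 - gauss_exp I).
  rewrite -e1 -gauss_expD//; apply: le_gauss_exp => //; first exact: bounded_measurableD.
  by move=> u; have := I01 u; have := cos_le1 (lam * u + nu); nra.
have lo : gauss_exp (fun u => I u * cos (lam * u + nu)) - (1 - gauss_exp I) <=
    gauss_exp (fun u => cos (lam * u + nu)).
  rewrite lerBlDr -e1 -gauss_expD//; apply: le_gauss_exp => //; first exact: bounded_measurableD.
  by move=> u; have := I01 u; have := cos_geN1 (lam * u + nu); nra.
have d : `|expR (- (lam ^+ 2 / 2)) * (cos nu * gauss_exp I) - expR (- (lam ^+ 2 / 2)) * cos nu| <=
    1 - gauss_exp I.
  rewrite mulrA -{2}[_ * cos nu]mulr1 -mulrBr normrM.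
  have gI : gauss_exp I <= 1.
    rewrite -[leRHS](gauss_exp_cst 1); apply: le_gauss_exp => //.
      by apply: (@bounded_measurable_continuous _ 1) => [u|u]; [exact: cvg_cst|rewrite normr1].
    by move=> u; have /andP[] := I01 u.
  rewrite distrC (ger0_norm (_ : 0 <= 1 - _)); last by rewrite subr_ge0.
  rewrite ler_piMl ?subr_ge0// normrM mulr_ile1 ?cos_max// ger0_norm ?expR_ge0//.
  by rewrite expR_le1 oppr_le0 divr_ge0// sqr_ge0.
by move: h d; rewrite -/I !ler_norml => /andP[? ?] /andP[? ?]; apply/andP; split; lra.
Qed.

End truncated.

Lemma gauss_exp_cos lam nu :
  gauss_exp (fun u => cos (lam * u + nu)) = expR (- (lam ^+ 2 / 2)) * cos nu.
Proof.
apply/eqP; rewrite -subr_eq0 -normr_le0; apply/ler_addgt0Pr => e e0; rewrite add0r.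
have e80 : 0 < e / 8 by rewrite divr_gt0.
have /cvgrPdist_le/(_ _ e80) hy := cvg_Phi_y.
have /cvgNy_compNP/cvgrPdist_le/(_ _ e80) hNy := cvg_Phi_Ny.
near (+oo : set_system R) => A.
have A1 : 1 <= A by near: A; exact: nbhs_pinfty_ge.
have A2 : 8 * `|lam| / e <= A by near: A; apply: nbhs_pinfty_ge; exact: num_real.
have A0 : 0 < A by lra.
have h1 : `|1 - Phi A| <= e / 8 by near: A.
have h2 : `|0 - Phi (- A)| <= e / 8 by near: A.
have hI : Phi A <= gauss_exp \1_`[- A, A] + Phi (- A).
  rewrite !PhiE -gauss_expD; last 2 first.
  - exact: bounded_measurable_indic.
  - exact: bounded_measurable_indic.
  apply: le_gauss_exp.
  - exact: bounded_measurable_indic.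
  - by apply: bounded_measurableD; exact: bounded_measurable_indic.
  move=> u; rewrite !indicE !mem_setE !in_itv/= -natrD ler_nat.
  by case: (leP u A) => uA //; case: (leP (- A) u) => //= uA'; rewrite (ltW uA').
apply: (le_trans (gauss_exp_cos_truncated nu A0 lam)).
have h3 : expR (- A ^+ 2 / 2) <= 2 / A.
  have := expR_ge1Dx (A ^+ 2 / 2); rewrite mulNr expRN => h.
  have p : 0 < A / 2 by lra.
  have -> : 2 / A = (A / 2)^-1 by rewrite invf_div.
  rewrite lef_pV2 ?posrE ?expR_gt0//; apply: le_trans h; nra.
have h4 : 2 * `|lam| * expR (- A ^+ 2 / 2) <= e / 2.
  apply: (le_trans (ler_wpM2l (_ : 0 <= 2 * `|lam|) h3)); first by rewrite mulr_ge0.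
  rewrite mulrA ler_pdivrMr//; move: A2; rewrite ler_pdivrMr//; lra.
by move: h1 h2; rewrite !ler_norml => /andP[? ?] /andP[? ?]; lra.
Unshelve. all: by end_near. Qed.

End gaussian.

(** * From trigonometric averages to distribution functions *)

Section step_poly.
Variable R : realType.
Implicit Types (x k : R) (n : nat).

(* [(1 - v ^ n) ^ (2 ^ n)] with [v = (1 + x) / 2] tends to the indicator of
   [x < 0] on [-1, 1], uniformly away from [0]. *)
Definition step_poly n : {poly R} :=
  (1 - ((2^-1)%:P * (1 + 'X)) ^+ n) ^+ (2 ^ n).

Lemma step_polyE n x : (step_poly n).[x] = (1 - (2^-1 * (1 + x)) ^+ n) ^+ (2 ^ n).
Proof. by rewrite /step_poly !hornerE. Qed.

Lemma step_base n x : -1 <= x <= 1 -> 0 <= (2^-1 * (1 + x)) ^+ n <= 1.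
Proof.
move=> /andP[x0 x1]; rewrite exprn_ge0 ?exprn_ile1//; lra.
Qed.

Lemma step_poly01 n x : -1 <= x <= 1 -> 0 <= (step_poly n).[x] <= 1.
Proof.
move=> /(step_base n) /andP[v0 v1]; rewrite step_polyE exprn_ge0 ?exprn_ile1//; lra.
Qed.

Lemma bernoulli_ineq (y : R) m : 0 <= y <= 1 -> 1 - m%:R * y <= (1 - y) ^+ m.
Proof.
move=> /andP[y0 y1]; elim: m => [|m IH]; first by rewrite mul0r subr0 expr0.
have h : 0 <= (1 - y) ^+ m by rewrite exprn_ge0// subr_ge0.
have m0 : 0 <= m%:R :> R by [].
rewrite exprS -natr1; apply: le_trans (ler_wpM2l _ IH); last by rewrite subr_ge0.
have := mulr_ge0 m0 (mulr_ge0 y0 y0); lra.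
Qed.

Lemma inv_pow_le (k : R) n : 0 < k -> ((1 + k) ^+ n)^-1 <= (1 + n%:R * k)^-1.
Proof.
move=> k0; have n0 : 0 <= n%:R :> R by [].
have p : 0 < 1 + n%:R * k by have := mulr_ge0 n0 (ltW k0); lra.
rewrite lef_pV2 ?posrE ?exprn_gt0//; last by lra.
elim: n {n0 p} => [|n IH]; first by rewrite mul0r addr0 expr0.
rewrite exprS -natr1; apply: le_trans (ler_wpM2l _ IH); last by lra.
have := mulr_ge0 (ler0n R n) (mulr_ge0 (ltW k0) (ltW k0)); lra.
Qed.

(** The outer exponent [2 ^ n] matches the factor [1 / 2] in the base:
    [2 ^ n * v ^ n = (1 + x) ^ n]. Bernoulli's inequality leaves this power, small since
    [1 - k <= 1 / (1 + k)]. *)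
Lemma step_poly_left n x k : -1 <= x -> x <= - k -> 0 < k ->
  1 - (1 + n%:R * k)^-1 <= (step_poly n).[x].
Proof.
move=> x1 xk k0.
have x11 : -1 <= x <= 1 by apply/andP; split; lra.
have hb := step_base n x11.
rewrite step_polyE; apply: le_trans (bernoulli_ineq (2 ^ n) hb).
rewrite lerD2l lerN2 natrX -exprMn; apply: le_trans (inv_pow_le n k0).
have -> : 2 * (2^-1 * (1 + x)) = 1 + x by field.
rewrite -exprVn lerXn2r ?nnegrE ?invr_ge0//; try lra.
rewrite -[leRHS]mul1r ler_pdivlMr; last by lra.
by nra.
Qed.

(** Here [(1 - y) ^ m <= expR (- m * y)], where [m * y] is again [(1 + x) ^ n], now at least
    [(1 + k) ^ n]. *)
Lemma step_poly_right n x k : x <= 1 -> k <= x -> 0 < k ->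
  (step_poly n).[x] <= (1 + n%:R * k)^-1.
Proof.
move=> x1 kx k0.
have x11 : -1 <= x <= 1 by apply/andP; split; lra.
have /andP[v0 v1] := step_base n x11.
rewrite step_polyE; apply: le_trans (inv_pow_le n k0).
set y := (2^-1 * (1 + x)) ^+ n in v0 v1 *.
have h : 1 - y <= expR (- y) by exact: expR_ge1Dx.
apply: (@le_trans _ _ (expR (- y) ^+ (2 ^ n))).
  by rewrite lerXn2r ?nnegrE ?expR_ge0//; lra.
rewrite -expRM_natl mulrN expRN lef_pV2 ?posrE ?expR_gt0 ?exprn_gt0//; last by lra.
rewrite natrX /y -exprMn (_ : 2 * (2^-1 * (1 + x)) = 1 + x); last by field.
apply: (@le_trans _ _ ((1 + x) ^+ n)); first by rewrite lerXn2r ?nnegrE//; lra.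
by have := expR_ge1Dx ((1 + x) ^+ n); lra.
Qed.

End step_poly.

(** * Distribution functions for an abstract averaging functional *)

Section levy.
Variable R : realType.
Variable E : nat -> (R -> R) -> R.
Hypothesis ED : forall N f g, E N (fun u => f u + g u) = E N f + E N g.
Hypothesis EZ : forall N c f, E N (fun u => c * f u) = c * E N f.
Hypothesis Ele : forall N f g, (forall u, f u <= g u) -> E N f <= E N g.
Hypothesis Ecos : forall lam nu : R,
  (fun N => E N (fun u => cos (lam * u + nu))) @ \oo --> expR (- (lam ^+ 2 / 2)) * cos nu.
Hypothesis E1 : forall N, E N (fun=> 1) <= 1.
Variable A : R.
Hypothesis Etight : \forall N \near \oo, E N (fun u => `|u|) <= A.

Definition gauss_limit (f : R -> R) :=
  bounded_measurable f /\ (fun N => E N f) @ \oo --> gauss_exp f.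

Lemma gauss_limitD f g : gauss_limit f -> gauss_limit g -> gauss_limit (fun u => f u + g u).
Proof.
move=> [bf lf] [bg lg]; split; first exact: bounded_measurableD.
rewrite gauss_expD//; under eq_fun do rewrite ED; exact: cvgD.
Qed.

Lemma gauss_limitZ c f : gauss_limit f -> gauss_limit (fun u => c * f u).
Proof.
move=> [bf lf]; split; first exact: bounded_measurableZ.
rewrite gauss_expZ//; under eq_fun do rewrite EZ; apply: cvgM lf; exact: cvg_cst.
Qed.

Lemma gauss_limit_cos (lam nu : R) : gauss_limit (fun u => cos (lam * u + nu)).
Proof.
split; first exact: bounded_measurable_cos.
by rewrite gauss_exp_cos; exact: Ecos.
Qed.

(** The product formula for [sin X * cos Y], with sines written as cosines shifted by [pi / 2],
    lowers the power at the price of new frequencies and phases. *)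
Lemma gauss_limit_sin_pow (t c : R) j (lam nu : R) :
  gauss_limit (fun u => sin (t * u + c) ^+ j * cos (lam * u + nu)).
Proof.
elim: j lam nu => [|j IH] lam nu.
  by have := gauss_limit_cos lam nu; congr gauss_limit; apply/funext => u; rewrite expr0 mul1r.
have h1 := IH (t + lam) (c + nu - pi / 2); have h2 := IH (t - lam) (c - nu - pi / 2).
have := gauss_limitZ 2^-1 (gauss_limitD h1 h2); congr gauss_limit; apply/funext => u.
have -> : (t + lam) * u + (c + nu - pi / 2) = (t * u + c) + (lam * u + nu) - pi / 2 by ring.
have -> : (t - lam) * u + (c - nu - pi / 2) = (t * u + c) - (lam * u + nu) - pi / 2 by ring.
by move: (t * u + c) (lam * u + nu) => X Y; rewrite !cosBpihalf sinD sinB exprS; field.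
Qed.

Lemma gauss_limit_poly (t c : R) (p : {poly R}) : gauss_limit (fun u => p.[sin (t * u + c)]).
Proof.
have -> : (fun u => p.[sin (t * u + c)]) =
    (fun u => \sum_(i < size p) p`_i * sin (t * u + c) ^+ i).
  by apply/funext => u; rewrite horner_coef.
have h j : gauss_limit (fun u => sin (t * u + c) ^+ j).
  have := gauss_limit_sin_pow t c j 0 0; congr gauss_limit.
  by apply/funext => u; rewrite mul0r addr0 cos0 mulr1.
elim: (size p) => [|m IH].
  have := gauss_limitZ 0 (h 0%N); congr gauss_limit.
  by apply/funext => u; rewrite big_ord0 mul0r.
have := gauss_limitD IH (gauss_limitZ p`_m (h m)); congr gauss_limit.
by apply/funext => u; rewrite big_ord_recr.
Qed.

Let ind (a u : R) : R := (u <= a)%R%:R.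

Lemma indE (a : R) : ind a = \1_`]-oo, a].
Proof. by apply/funext => u; rewrite indicE mem_setE in_itv. Qed.

(* A smooth step at [b], exact up to [e] at distance [d] from [b] within the
   window [-T, T]. *)
Lemma smooth_step (b d T e : R) : 0 < d -> d < T -> 0 < e ->
  exists2 q : R -> R, gauss_limit q &
  [/\ forall u, 0 <= q u <= 1,
      forall u, - T <= u -> u <= b - d -> 1 - e <= q u &
      forall u, b + d <= u -> u <= T -> q u <= e].
Proof.
move=> d0 dT e0; have T0 : 0 < T by lra.
(* With this scale [t * (u - b)] stays in [[- pi / 2, pi / 2]], where the sine increases, for all
   [u] in the window. *)
pose L := T + `|b|; have b0 := normr_ge0 b; have L0 : 0 < L by rewrite /L; lra.
pose t := (pi / 2) / L; have pi2 : 0 < pi / 2 :> R by rewrite divr_gt0// pi_gt0.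
have t0 : 0 < t by rewrite divr_gt0.
have tL : t * L = pi / 2 by rewrite divfK// gt_eqF.
have td0 : 0 < t * d by rewrite mulr_gt0.
have tdL : t * d < pi / 2 by rewrite -tL ltr_pM2l// /L; lra.
pose k := sin (t * d); have k0 : 0 < k.
  by apply: sin_gt0_pihalf; rewrite td0.
pose n := (Num.truncn (e^-1 / k)).+1.
have ne : (1 + n%:R * k)^-1 <= e.
  have nk : e^-1 < n%:R * k by rewrite -ltr_pdivrMr// truncnS_gt.
  have ei : 0 < e^-1 by rewrite invr_gt0.
  by rewrite -[e]invrK lef_pV2 ?posrE//; lra.
have mono x y : - (pi / 2) <= x -> x <= y -> y <= pi / 2 -> sin x <= sin y :> R.
  move=> x0 xy y1; rewrite le_eqVlt; move: xy; rewrite le_eqVlt => /predU1P[->|xy].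
    by rewrite eqxx.
  by rewrite ltr_sin ?xy ?orbT// in_itv/=; apply/andP; split; lra.
have bl := ler_norm b; have bl' : - `|b| <= b by rewrite lerNl -normrN ler_norm.
exists (fun u => (step_poly R n).[sin (t * u + - (t * b))]); first exact: gauss_limit_poly.
split=> u.
- by apply: step_poly01; rewrite sin_geN1 sin_le1.
- move=> Tu ub; apply: le_trans (step_poly_left n (sin_geN1 _) _ k0); first by rewrite lerD2l lerN2.
  rewrite /k -sinN -mulrN -mulrDr; apply: mono.
  + rewrite -tL -mulrN ler_pM2l// /L; lra.
  + rewrite -mulrN ler_pM2l//; lra.
  + lra.
- move=> bu uT; apply: (@le_trans _ _ (1 + n%:R * k)^-1) => //.
  apply: step_poly_right => //.
  rewrite /k -mulrN -mulrDr; apply: mono.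
  + lra.
  + rewrite ler_pM2l//; lra.
  + rewrite -tL ler_pM2l// /L; lra.
Qed.

Lemma levy (a eta e : R) : 0 < eta -> 0 < e -> \forall N \near \oo,
  Phi (a - eta) - e <= E N (fun u => (u <= a)%R%:R) /\
  E N (fun u => (u <= a)%R%:R) <= Phi (a + eta) + e.
Proof.
move=> eta0 e0; pose d := eta / 2; have d0 : 0 < d by rewrite divr_gt0.
have e80 : 0 < e / 8 by rewrite divr_gt0.
have e16 : 0 < e / 16 by rewrite divr_gt0.
have [T [dT AT T0 PT PNT]] : exists T : R, [/\ d < T, `|A| / T <= e / 8, 0 < T,
    1 - Phi T <= e / 8 & Phi (- T) <= e / 8].
  have /cvgrPdist_le/(_ _ e80) hy := @cvg_Phi_y R.
  have /cvgNy_compNP/cvgrPdist_le/(_ _ e80) hNy := @cvg_Phi_Ny R.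
  near (+oo : set_system R) => T.
  have dT : d + 1 <= T by near: T; apply: nbhs_pinfty_ge; exact: num_real.
  have AT : `|A| * 8 / e <= T by near: T; apply: nbhs_pinfty_ge; exact: num_real.
  have h1 : `|1 - Phi T| <= e / 8 by near: T.
  have h2 : `|0 - Phi (- T)| <= e / 8 by near: T.
  have T0 : 0 < T by lra.
  exists T; split => //.
  - lra.
  - by rewrite ler_pdivrMr//; move: AT; rewrite ler_pdivrMr//; lra.
  - exact: le_trans (ler_norm _) h1.
  - by move: h2; rewrite sub0r normrN; apply: le_trans; exact: ler_norm.
(* As [eta = 2 * d], the step at [a + d] falls between [a] and [a + eta], and the one at [a - d]
   between [a - eta] and [a]. *)
have [q1 [bq1 lq1] [q1b q1l q1r]] := @smooth_step (a + d) d T (e / 16) d0 dT e16.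
have [q2 [bq2 lq2] [q2b q2l q2r]] := @smooth_step (a - d) d T (e / 16) d0 dT e16.
have bi (c : R) : bounded_measurable (ind c).
  by rewrite indE; apply: bounded_measurable_indic.
have iP (c : R) : gauss_exp (ind c) = Phi c by rewrite indE PhiE.
have bc (c : R) : bounded_measurable (fun=> c).
  by apply: (@bounded_measurable_continuous _ _ `|c|) => // u; exact: cvg_cst.
have absT (u : R) : T < `|u| -> 1 <= T^-1 * `|u|.
  by move=> Tu; rewrite mulrC ler_pdivlMr// mul1r ltW.
have absT0 (u : R) : 0 <= T^-1 * `|u| by rewrite mulr_ge0// invr_ge0 ltW.
have m1 := bounded_measurableZ (-1) (bi T); have m2 := bounded_measurableD (bc 1) m1.
have m3 := bounded_measurableD (bc (e / 16)) m2.
have G1 : gauss_exp q1 <= Phi (a + eta) + e / 16 + e / 8.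
  have : gauss_exp q1 <= gauss_exp (fun u => ind (a + eta) u + (e / 16 + (1 + (-1) * ind T u))).
    apply: le_gauss_exp => //; first exact: bounded_measurableD.
    move=> u; have /andP[_ u1] := q1b u; rewrite /ind.
    case: (leP u (a + eta)) => ua; case: (leP u T) => uT; rewrite /=; try lra.
    have au : a + d + d <= u by rewrite /d; lra.
    by have := q1r u au uT; lra.
  rewrite (gauss_expD (bi _) m3) (gauss_expD (bc _) m2) (gauss_expD (bc _) m1).
  by rewrite (gauss_expZ _ (bi _)) !gauss_exp_cst !iP; lra.
have G2 : Phi (a - eta) <= gauss_exp q2 + e / 16 + e / 8.
  have : gauss_exp (ind (a - eta)) <= gauss_exp (fun u => q2 u + (e / 16 + ind (- T) u)).
    apply: le_gauss_exp => //; first by apply: bounded_measurableD => //; exact: bounded_measurableD.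
    move=> u; have /andP[u0 u1] := q2b u; rewrite /ind.
    case: (leP u (a - eta)) => ua; case: (leP u (- T)) => uT; rewrite /=; try lra.
    have au : u <= a - d - d by rewrite /d; lra.
    by have := q2l u (ltW uT) au; lra.
  rewrite !gauss_expD//; last exact: bounded_measurableD.
  by rewrite !gauss_exp_cst !iP; lra.
have /cvgrPdist_le/(_ _ e80) l1 := lq1; have /cvgrPdist_le/(_ _ e80) l2 := lq2.
near=> N.
have n1 : `|gauss_exp q1 - E N q1| <= e / 8 by near: N.
have n2 : `|gauss_exp q2 - E N q2| <= e / 8 by near: N.
have EA : T^-1 * E N (fun u => `|u|) <= e / 8.
  apply: le_trans AT; rewrite mulrC ler_wpM2r ?invr_ge0 ?(ltW T0)//.
  by apply: (@le_trans _ _ A); [near: N|exact: ler_norm].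
have Ee : e / 16 * E N (fun=> 1) <= e / 16 by rewrite -[leRHS]mulr1 ler_pM2l.
(* Outside the window nothing is known of [q1] beyond its range, and [|u| / T >= 1] covers the
   difference, as in Markov's inequality. *)
have H1 : E N (ind a) <= E N q1 + (e / 16 + e / 8).
  apply: (@le_trans _ _ (E N (fun u => q1 u + (e / 16 * 1 + T^-1 * `|u|)))); last first.
    by rewrite !ED !EZ; lra.
  apply: Ele => u; have /andP[u0 u1] := q1b u; have := absT0 u; rewrite /ind.
  case: (leP u a) => ua /=; last by lra.
  case: (leP (- T) u) => uT.
    have au : u <= a + d - d by rewrite addrK.
    by have := q1l u uT au; lra.
  have Tu : T < `|u| by rewrite ltr0_norm; lra.
  by have := absT u Tu; lra.
have H2 : E N q2 <= E N (ind a) + (e / 16 + e / 8).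
  apply: (@le_trans _ _ (E N (fun u => ind a u + (e / 16 * 1 + T^-1 * `|u|)))); last first.
    by rewrite !ED !EZ; lra.
  apply: Ele => u; have /andP[u0 u1] := q2b u; have := absT0 u; rewrite /ind.
  case: (leP u a) => ua /=; first by lra.
  case: (leP u T) => uT.
    have au : a - d + d <= u by rewrite subrK ltW.
    by have := q2r u au uT; lra.
  have Tu : T < `|u| by rewrite gtr0_norm; lra.
  by have := absT u Tu; lra.
move: n1 n2; rewrite !ler_norml -/(ind a) => /andP[? ?] /andP[? ?]; split; lra.
Unshelve. all: by end_near. Qed.

End levy.

(** * Distribution of [omega1] on [h]-free integers *)

Section erdos_kac.
Variable R : realType.
Variable h : nat.
Hypothesis h2 : (2 <= h)%N.

Lemma levy_hfree (a eta e : R) : 0 < eta -> 0 < e -> \forall N \near \oo,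
  Phi (a - eta) - e <= havg h N (fun n => (WN R N n <= a)%R%:R) /\
  havg h N (fun n => (WN R N n <= a)%R%:R) <= Phi (a + eta) + e.
Proof.
have [A hA] := havg_abs_WN_bounded R h2.
apply: (@levy R (fun N f => havg h N (f \o WN R N)) _ _ _ _ _ A hA).
- move=> N f g; rewrite /havg -mulrDl -big_split/=; congr (_ / _).
  by apply: eq_bigr => n _; rewrite mulrDr.
- move=> N c f; rewrite /havg mulrA mulr_sumr; congr (_ / _).
  by apply: eq_bigr => n _; rewrite mulrCA.
- move=> N f g fg; rewrite /havg; apply: ler_wpM2r.
    by rewrite invr_ge0; apply: sumr_ge0 => n _; exact: hf_ge0.
  by apply: ler_sum => n _; rewrite ler_wpM2l ?hf_ge0//= fg.
- by move=> lam nu; exact: cvg_havg_cos.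
- move=> N; rewrite /havg/=; under eq_bigr do rewrite mulr1.
  have [->|N0] := posnP N; first by rewrite big_geq// mul0r.
  by rewrite divff// gt_eqF// hf_sum_gt0.
Qed.

Definition stat (n : nat) : R := ((omega1 n)%:R - loglog R n) / Num.sqrt (loglog R n).

(* For [n ^ 2 > N] one has [LL N - ln 2 <= loglog n <= LL N]. *)
Lemma stat_WN (N n : nat) (a eta : R) : 2 <= LL R N ->
  (`|a| + 1) / eta <= Num.sqrt (LL R N) -> 0 < eta ->
  (0 < n <= N)%N -> (N < n ^ 2)%N ->
  (stat n <= a -> WN R N n <= a + eta) /\ (WN R N n <= a - eta -> stat n <= a).
Proof.
move=> L2 Lbig eta0 /andP[n0 nN] Nn.
have lN : 1 < ln N%:R :> R.
  rewrite ltNge; apply/negP => l1; have : LL R N <= 0 by exact: ln_le0.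
  by lra.
have lN0 : 0 < ln N%:R :> R by lra.
have nR : 0 < n%:R :> R by rewrite ltr0n.
have NR : 0 < N%:R :> R by rewrite ltr0n (leq_trans n0).
have lnN : ln n%:R <= ln N%:R :> R by rewrite ler_ln ?posrE// ler_nat.
have lNn : ln N%:R <= 2 * ln n%:R :> R.
  rewrite mulrC mulr_natr -lnXn// ler_ln ?posrE ?exprn_gt0// -natrX ler_nat ltnW//.
have ln0 : 0 < ln n%:R :> R by lra.
have lL : loglog R n <= LL R N by rewrite /LL /loglog ler_ln ?posrE.
have ln21 : ln 2 <= 1 :> R by rewrite -[2]/(1 + 1)%R le_ln1Dx.
have Ll : LL R N <= loglog R n + 1.
  apply: (@le_trans _ _ (ln 2 + loglog R n)); last lra.
  by rewrite /LL /loglog -lnM ?posrE// ler_ln ?posrE// mulr_gt0.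
rewrite /stat /WN; move: (loglog R n) (LL R N) L2 Lbig lL Ll => l L L2 Lbig lL Ll.
have l1 : 1 <= l by lra.
set s := Num.sqrt l; set S := Num.sqrt L.
have ss : s ^+ 2 = l by rewrite sqr_sqrtr//; lra.
have SS : S ^+ 2 = L by rewrite sqr_sqrtr//; lra.
have s1 : 1 <= s by rewrite -[1]sqrtr1 ler_sqrt//; lra.
have sS : s <= S by rewrite ler_sqrt//; lra.
have sS1 : S - s <= 1.
  by rewrite leNgt; apply/negP => hh; have : 1 < (S - s) * (S + s); nra.
have s0 : 0 < s by lra. have S0 : 0 < S by lra.
have aS : `|a * s - a * S| <= `|a|.
  rewrite -mulrBr normrM ler_piMr// distrC ger0_norm; lra.
(* [|a|] pays for replacing [s] by [S], and [1] for replacing the centre [l] by [L]. *)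
have eS : `|a| + 1 <= eta * S by move: Lbig; rewrite ler_pdivrMr// mulrC.
move: aS; rewrite ler_norml => /andP[aS1 aS2].
split; rewrite !ler_pdivrMr// => hw; lra.
Qed.

(** At most [sqrt N] integers are counted, and [sqrt N <= e * N]. *)
Lemma sum_small_le (N : nat) (e : R) : 0 < e -> (e^-1) ^+ 2 <= N%:R -> (0 < N)%N ->
  \sum_(1 <= n < N.+1) ((n ^ 2 <= N)%N)%:R <= e * N%:R :> R.
Proof.
move=> e0 eN N0; have [r /and3P[r0 rN Nr]] := @root_exists 2 N isT N0.
have NR : 0 < N%:R :> R by rewrite ltr0n.
apply: (@le_trans _ _ r%:R).
  rewrite -natr_sum ler_nat -big_mkcond/= sum1_count -size_filter.
  rewrite -[X in (_ <= X)%N](size_iota 1 r); apply: uniq_leq_size.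
    by rewrite filter_uniq ?iota_uniq.
  move=> n; rewrite mem_filter mem_index_iota mem_iota => /and3P[nN n0 _].
  rewrite n0/= addnC addn1 -(@ltn_exp2r _ _ 2)//.
  exact: leq_ltn_trans nN Nr.
rewrite -ler_sqr ?nnegrE ?mulr_ge0 ?(ltW e0)//.
apply: (@le_trans _ _ N%:R); first by rewrite -natrX ler_nat.
rewrite exprMn expr2 mulrA ler_peMl ?(ltW NR)//.
have := ler_wpM2l (sqr_ge0 e) eN.
by rewrite -exprMn divff ?gt_eqF// expr1n -expr2.
Qed.

Lemma ncard_pred (N : nat) (A : set nat) (P : pred nat) :
  A = [set n | (0 < n <= N)%N && P n] ->
  (ncard A)%:R = \sum_(1 <= n < N.+1) (P n)%:R :> R.
Proof.
move=> ->; rewrite /ncard.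
have -> : fset_set [set n | (0 < n <= N)%N && P n] = [fset n in [seq n <- index_iota 1 N.+1 | P n]]%fset.
  apply/fsetP => n; rewrite in_fset_set.
    by rewrite mem_setE !inE mem_filter mem_index_iota ltnS [RHS]andbC.
  apply: (@sub_finite_set _ _ `I_N.+1); last exact: finite_II.
  by move=> k /= /andP[/andP[_ kN] _].
rewrite card_fseq undup_id ?filter_uniq ?iota_uniq// size_filter -sum1_count natr_sum.
by rewrite big_mkcond/=; apply: eq_bigr => n _; case: (P n).
Qed.

Let SH (N : nat) : R := \sum_(1 <= n < N.+1) hf R h n.

Lemma hfree_uptoE (x : R) : 0 <= x ->
  hfree_upto h x = [set n | (0 < n <= Num.truncn x)%N && hfree h n].
Proof.
move=> x0; apply/seteqP; split=> n /=.
  by move=> [n0 [hn nx]]; rewrite n0 hn truncn_ge_nat// nx.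
by move=> /andP[/andP[n0 nx] hn]; rewrite truncn_ge_nat in nx.
Qed.

Lemma ncard_hfree_upto (x : R) : 0 <= x ->
  (ncard (hfree_upto h x))%:R = SH (Num.truncn x).
Proof. by move=> x0; rewrite (ncard_pred (hfree_uptoE x0)). Qed.

Lemma ncard_hfree_stat (a x : R) : 0 <= x ->
  (ncard [set n | hfree_upto h x n /\ (3 <= n)%N /\
    ((omega1 n)%:R - loglog R n) / Num.sqrt (loglog R n) <= a])%:R =
  \sum_(1 <= n < (Num.truncn x).+1) hf R h n * ((3 <= n)%N && (stat n <= a)%R)%:R.
Proof.
move=> x0; rewrite (@ncard_pred (Num.truncn x) _
    (fun n => hfree h n && ((3 <= n)%N && (stat n <= a)%R))).
  by apply: eq_bigr => n _; rewrite -mulnb natrM.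
rewrite hfree_uptoE//; apply/seteqP; split=> n /=.
  by move=> [/andP[-> ->] [-> ]]; rewrite /stat => ->.
by move=> /andP[-> /andP[-> /andP[-> ]]].
Qed.

Lemma stat_distribution (a e : R) : 0 < e -> \forall N \near \oo,
  `|Phi a - havg h N (fun n => ((3 <= n)%N && (stat n <= a)%R)%:R)| <= e.
Proof.
(* The total error is [4 * eta]: a shift of [2 * eta] in the argument of [Phi], [eta] from
   [levy_hfree], and [eta] from the [n] with [n ^ 2 <= N]. For these the precision is [eta / 4], as
   the [h]-free integers have proportion at least [1 / 4]. *)
move=> e0; pose eta := e / 8; have eta0 : 0 < eta by rewrite divr_gt0.
have e40 : 0 < eta / 4 by rewrite divr_gt0.
have hup := levy_hfree (a + eta) eta0 eta0.
have hlo := levy_hfree (a - eta) eta0 eta0.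
near=> N.
have N0 : (0 < N)%N by near: N; exact: nbhs_infty_gt.
have N9 : (9 <= N)%N by near: N; exact: nbhs_infty_ge.
have L2 : 2 <= LL R N by near: N; exact: near_LL.
have Lb : ((`|a| + 1) / eta) ^+ 2 <= LL R N by near: N; exact: near_LL.
have NR : 0 < N%:R :> R by rewrite ltr0n.
have eN : ((eta / 4)^-1) ^+ 2 <= N%:R by near: N; exact: nbhs_infty_ger.
have S4 : 4^-1 <= SH N / N%:R by near: N; exact: hfree_density_ge.
have S0 : 0 < SH N := hf_sum_gt0 R h N0.
have Lbig : (`|a| + 1) / eta <= Num.sqrt (LL R N).
  have p : 0 <= (`|a| + 1) / eta by rewrite divr_ge0 ?(ltW eta0)// addr_ge0.
  rewrite -(ger0_norm p) -sqrtr_sqr ler_sqrt//; first by apply: le_trans Lb; exact: sqr_ge0.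
have [_ up] : Phi (a + eta - eta) - eta <= havg h N (fun n => (WN R N n <= a + eta)%R%:R) /\
  havg h N (fun n => (WN R N n <= a + eta)%R%:R) <= Phi (a + eta + eta) + eta by near: N.
have [lo _] : Phi (a - eta - eta) - eta <= havg h N (fun n => (WN R N n <= a - eta)%R%:R) /\
  havg h N (fun n => (WN R N n <= a - eta)%R%:R) <= Phi (a - eta + eta) + eta by near: N.
have small : havg h N (fun n => ((n ^ 2 <= N)%N)%:R) <= eta.
  rewrite /havg ler_pdivrMr//.
  apply: (@le_trans _ _ (eta / 4 * N%:R)).
    apply: le_trans (sum_small_le e40 eN N0); apply: ler_sum => n _.
    by rewrite ler_piMl// /hf; case: hfree.
  by rewrite -/(SH N) -mulrA ler_pM2l// -ler_pdivlMr.
have havgD f g : havg h N (fun n => f n + g n) = havg h N f + havg h N g :> R.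
  rewrite /havg -mulrDl -big_split/=; congr (_ / _).
  by apply: eq_bigr => n _; rewrite mulrDr.
have le_havg f g : (forall n, (0 < n <= N)%N -> f n <= g n) -> havg h N f <= havg h N g :> R.
  move=> fg; rewrite /havg; apply: ler_wpM2r; first by rewrite invr_ge0 ltW.
  rewrite big_nat_cond [leRHS]big_nat_cond; apply: ler_sum => n /andP[nN _].
  by rewrite ler_wpM2l ?hf_ge0// fg.
have u1 : havg h N (fun n => ((3 <= n)%N && (stat n <= a)%R)%:R) <=
    havg h N (fun n => (WN R N n <= a + eta)%R%:R) + havg h N (fun n => ((n ^ 2 <= N)%N)%:R) :> R.
  rewrite -havgD; apply: le_havg => n nN; rewrite -natrD ler_nat.
  have [//|Nn] := leqP (n ^ 2) N; first by rewrite addn1; case: (_ && _).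
  have [w _] := stat_WN L2 Lbig eta0 nN Nn; rewrite addn0.
  by case: (boolP (_ && _)) => // /andP[_ /w ->].
have l1 : havg h N (fun n => (WN R N n <= a - eta)%R%:R) <=
    havg h N (fun n => ((3 <= n)%N && (stat n <= a)%R)%:R) + havg h N (fun n => ((n ^ 2 <= N)%N)%:R) :> R.
  rewrite -havgD; apply: le_havg => n nN; rewrite -natrD ler_nat.
  have [//|Nn] := leqP (n ^ 2) N; first by rewrite addn1; case: (_ <= _)%R.
  have [_ w] := stat_WN L2 Lbig eta0 nN Nn; rewrite addn0.
  case: (boolP (_ <= _)%R) => // /w ->; rewrite andbT.
  (* The condition [3 <= n] is automatic here, since [n ^ 2 > N >= 9]. *)
  have -> // : (3 <= n)%N.
  rewrite ltnNge -(@leq_exp2r _ _ 2)// -ltnNge; apply: leq_ltn_trans Nn.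
  exact: leq_trans N9.
have P1 := Phi_lipschitz a (ltW (addr_gt0 eta0 eta0)).
have P2 := Phi_lipschitz (a - eta - eta) (ltW (addr_gt0 eta0 eta0)).
rewrite (_ : a - eta - eta + (eta + eta) = a) in P2; last by ring.
rewrite addrA in P1.
rewrite ler_norml; apply/andP; split; rewrite /eta in P1 P2 up lo u1 l1 small *; lra.
Unshelve. all: by end_near. Qed.

End erdos_kac.

Theorem theorem1p5 (R : realType) (h : nat) (hh : (2 <= h)%N) (a : R) :
  (fun x : R =>
     (ncard [set n | hfree_upto h x n /\ (3 <= n)%N /\
               ((omega1 n)%:R - loglog R n) / Num.sqrt (loglog R n) <= a])%:R
     / (ncard (hfree_upto h x))%:R) @ +oo --> Phi a.
Proof.
apply/cvgrPdist_le => e e0; have [N0 _ hN] := @stat_distribution R h hh a e e0.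
near=> x.
have x0 : 0 <= x by near: x; apply: nbhs_pinfty_ge; exact: num_real.
rewrite ncard_hfree_stat// ncard_hfree_upto//; apply: hN => /=.
rewrite truncn_ge_nat//; near: x; apply: nbhs_pinfty_ge; exact: num_real.
Unshelve. all: by end_near. Qed.
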